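(* Let $(\Omega,d,\mu)$ be a doubling metric measure space with upper dimension $Q$ which satisfies the non-collapsing condition $\inf_{x\in\Omega}\mu(B(x,1))=b>0$. Let $X=L^{p,r}(\log L)^\beta$ be a Lorentz–Zygmund space on $\Omega$ ($0<p<\infty$, $0<r\le\infty$, $\beta\in\mathbb R$). Let $0<s<1$, $0<q\le\infty$. Write $\|f\|_{\dot B,q}$ for $\|f\|_{\dot B^s_{L^{p,r}(\log L)^\beta,q}}$. The following embeddings hold. (1) If $s<\frac Qp$, then $$\left(\int_0^1\left[t^{\frac1p-\frac sQ}\left(1+\ln\tfrac1t\right)^\beta f^*(t)\right]^q\frac{dt}t\right)^{1/q}\preceq\|f\|_{\dot B,q}+\|f\|_{L^{\min(1,r,p)}+L^\infty}$$ (for $0<q<\infty$) and $$\sup_{0<t<1}t^{\frac1p-\frac sQ}\left(1+\ln\tfrac1t\right)^\beta f^*(t)\preceq\|f\|_{\dot B,\infty}+\|f\|_{L^{\min(1,r,p)}+L^\infty}.$$ (2) If $s=\frac Qp$ and $$\begin{cases}\beta\le\frac1{\min(1,p,r)}-\frac1q&\text{if }\min(1,p,r)<q\le\infty,\\ \beta<0&\text{if }0<q\le\min(1,p,r),\end{cases}$$ then: (a) If $\min(1,r)<p$, or $\min(1,r)=p$ and $\beta\ge0$, then (i) if $\beta=\frac1{\min(1,r)}-\frac1q$ and $\min(1,r)<q\le\infty$, then $$\left(\int_0^1\frac{f^*(t)^q}{\left(1+\ln\frac1t\right)\left(1+\ln\left(1+\ln\frac1t\right)\right)^{\frac q{\min(1,r)}}}\frac{dt}t\right)^{1/q}\preceq\|f\|_{\dot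 B,q}+\|f\|_{L^{\min(1,r)}+L^\infty}$$ if $\min(1,r)<q<\infty$, and, if $q=\infty$, $$\sup_{0<t\le1}\frac{f^*(t)}{\left(1+\ln\left(1+\ln\frac1t\right)\right)^\beta}\preceq\|f\|_{\dot B,\infty}+\|f\|_{L^{\min(1,r)}+L^\infty};$$ (ii) if $\beta<\frac1{\min(1,r)}-\frac1q$ and $\min(1,r)<q\le\infty$, then $$\left(\int_0^1\left(\frac{f^*(t)}{\left(1+\ln\frac1t\right)^{\frac1{\min(1,r)}-\beta}}\right)^q\frac{dt}t\right)^{1/q}\preceq\|f\|_{\dot B,q}+\|f\|_{L^{\min(1,r)}+L^\infty}$$ if $\min(1,r)<q<\infty$, and, if $q=\infty$, $$\sup_{0<t\le1}\frac{f^*(t)}{\left(1+\ln\frac1t\right)^{\frac1{\min(1,r)}-\beta}}\preceq\|f\|_{\dot B,\infty}+\|f\|_{L^{\min(1,r)}+L^\infty};$$ (iii) if $\beta<0$ and $0<q\le\min(1,r)$, then $$\left(\int_0^1f^*(t)^q\left(1+\ln\tfrac1t\right)^{\beta q-1}\frac{dt}t\right)^{1/q}\preceq\|f\|_{\dot B,q}+\|f\|_{L^{\min(1,r)}+L^\infty}.$$ (b) If $p<\min(1,r)$, or $\min(1,r)=p$ and $\beta<0$, then for any $0<\alpha<p$ we have that (i) if $\beta\le\frac1p-\frac1q$ and $p\le q\le\infty$, then there is a positive constant $C_\alpha$, that blows up when $\alpha$ tends to $p$, such that $$\left(\int_0^1\left(\frac{f^*(t)}{\left(1+\ln\frac1t\right)^{\frac1\alpha-\beta}}\right)^q\frac{dt}t\right)^{1/q}\le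 C_\alpha\left(\|f\|_{\dot B,q}+\|f\|_{L^p+L^\infty}\right)$$ if $p\le q<\infty$, and, if $q=\infty$, $$\sup_{0<t\le1}\frac{f^*(t)}{\left(1+\ln\frac1t\right)^{\frac1\alpha-\beta}}\le C_\alpha\left(\|f\|_{\dot B,\infty}+\|f\|_{L^p+L^\infty}\right);$$ (ii) if $\beta<0$ and $0<q<p$, then $$\left(\int_0^1f^*(t)^q\left(1+\ln\tfrac1t\right)^{\beta q-1}\frac{dt}t\right)^{1/q}\preceq\|f\|_{\dot B,q}+\|f\|_{L^p+L^\infty}.$$
   Context: $A\preceq B$ means $A\le cB$ with $c>0$ independent of $f$; $1/\infty=0$. Doubling metric measure space: $(\Omega,d)$ is a metric space, $B(x,\rho)=\{y\in\Omega: d(x,y)<\rho\}$, and $\mu$ is a Borel measure with $0<\mu(B)<\infty$ for every ball $B$, such that for some $C>1$ one has $\mu(B(x,2\rho))\le C\mu(B(x,\rho))$ for all $x\in\Omega$, $\rho>0$; the smallest such $C$ is $C_\mu$, and $Q=\log_2C_\mu$ is the upper dimension. Standing assumptions: $\mu(\Omega)=\infty$ and $\mu(\{x\})=0$ for all $x\in\Omega$. For measurable $f$, $f^*(t)=\inf\{\sigma\ge0:\mu\{|f|>\sigma\}\le t\}$. The Lorentz–Zygmund space $L^{p,r}(\log L)^\beta$ consists of the measurable $f$ with finite quasi-norm $\left(\int_0^\infty\left[t^{1/p}\left(1+\ln^+\frac1t\right)^\beta f^*(t)\right]^r\frac{dt}t\right)^{1/r}$ if $r<\infty$, or $\sup_{t>0}t^{1/p}\left(1+\ln^+\frac1t\right)^\beta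 f^*(t)$ if $r=\infty$. For $0<\gamma\le 1$, $\|f\|_{L^\gamma+L^\infty}=\inf\{\|f_0\|_{L^\gamma}+\|f_1\|_{L^\infty}:f=f_0+f_1\}$. Besov seminorm: for $X=L^{p,r}(\log L)^\beta$ it is formed with a fixed exponent $0<\alpha\le1$ satisfying: $\alpha<p$ if ($0<p<r$ with $0<p\le1$) or ($0<p=r\le1$ and $\beta<0$); $\alpha=\min(1,r)$ otherwise. In part (2)(b) this $\alpha$ is the $\alpha<p$ appearing there. For such $\alpha$ the space $X^{(1/\alpha)}=\{f:|f|^{1/\alpha}\in X\}$, $\|f\|_{X^{(1/\alpha)}}=\||f|^{1/\alpha}\|_X^{\alpha}$, is (up to equivalence of norms) a Banach rearrangement invariant space. With $$\nabla_\rho^\alpha f(x)=\left(\frac1{\mu(B(x,\rho))}\int_{B(x,\rho)}|f(x)-f(y)|^\alpha d\mu(y)\right)^{1/\alpha},\qquad E_X(f,\rho)=\|\nabla^\alpha_\rho f\|_X,$$ $\|f\|_{\dot B^s_{X,q}}=\left(\int_0^\infty(\rho^{-s}E_X(f,\rho))^q\frac{d\rho}\rho\right)^{1/q}$ (supremum over $\rho>0$ if $q=\infty$). *)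

(* Defs.v *)
From HB Require Import structures.
From mathcomp Require Import all_boot all_order all_algebra.
From mathcomp Require Import all_classical all_reals all_analysis.

Set Implicit Arguments.
Unset Strict Implicit.
Unset Printing Implicit Defensive.
Import Order.TTheory GRing.Theory Num.Theory.
Import numFieldNormedType.Exports.

Local Open Scope classical_set_scope.
Local Open Scope ring_scope.
Local Open Scope ereal_scope.

(* A metric space that also carries a sigma-algebra; that the latter is the
   Borel one is the field [ds_borel] of [doubling_space]. *)
#[short(type="metricMeasurableType")]
HB.structure Definition MetricMeasurable (R : realType) (d : measure_display) :=
  {T of Metric R T & Measurable d T}.

Definition doubling_constant (R : realType) (d : measure_display)
    (Om : metricMeasurableType R d) (mu : {measure set Om -> \bar R}) (C : R) :
    Prop :=
  (1 < C)%R /\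
  forall (x : Om) (rho : R), (0 < rho)%R ->
    mu (ball x (2 * rho)%R) <= C%:E * mu (ball x rho).

Record doubling_space (R : realType) (d : measure_display)
    (Om : metricMeasurableType R d) (mu : {measure set Om -> \bar R}) : Prop :=
  DoublingSpace {
    ds_borel : @measurable d Om = <<s [set A : set Om | open A] >> ;
    ds_ball : forall (x : Om) (rho : R), (0 < rho)%R ->
      0 < mu (ball x rho) < +oo ;
    ds_doubling : exists C : R, doubling_constant mu C
  }.

Definition C_mu (R : realType) (d : measure_display)
    (Om : metricMeasurableType R d) (mu : {measure set Om -> \bar R}) : R :=
  inf [set C : R | doubling_constant mu C].

Definition upper_dimension (R : realType) (d : measure_display)
    (Om : metricMeasurableType R d) (mu : {measure set Om -> \bar R}) : R :=
  (ln (C_mu mu) / ln 2)%R.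

(* 1/q, with 1/oo = 0. *)
Definition recip (R : realType) (q : \bar R) : R := fine q^-1.

Definition min1 (R : realType) (r : \bar R) : R := fine (mine 1 r).

(* The integral of h(t) dt/t over D. *)
Definition int_dlog (R : realType) (D : set R) (h : R -> \bar R) : \bar R :=
  \int[lebesgue_measure]_(t in D) (h t * t^-1%:E).

Definition sup_on (R : realType) (D : set R) (h : R -> \bar R) : \bar R :=
  ereal_sup [set h t | t in D].

(* The exponents of interest are in ]0, +oo]. *)
Definition norm_dlog (R : realType) (q : \bar R) (h : R -> \bar R) : \bar R :=
  if q is q'%:E
  then int_dlog `]0%R, +oo[ (fun t => h t `^ q') `^ q'^-1
  else sup_on `]0%R, +oo[ h.

(* Functions are extended real-valued here because the gradients below may
   take the value +oo. *)
Definition rearrangement (R : realType) (d : measure_display)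
    (Om : measurableType d) (mu : {measure set Om -> \bar R})
    (g : Om -> \bar R) (t : R) : \bar R :=
  ereal_inf [set sigma%:E | sigma in
    [set sigma : R | (0 <= sigma)%R /\
                     mu [set x | sigma%:E < `|g x|] <= t%:E]].

Definition lorentz_zygmund (R : realType) (d : measure_display)
    (Om : measurableType d) (mu : {measure set Om -> \bar R})
    (p : R) (r : \bar R) (beta : R) (g : Om -> \bar R) : \bar R :=
  norm_dlog r (fun t =>
    (t `^ p^-1 * (1 + Num.max 0 (ln t^-1)) `^ beta)%R%:E
    * rearrangement mu g t).

Definition sum_norm (R : realType) (d : measure_display)
    (Om : measurableType d) (mu : {measure set Om -> \bar R})
    (gamma : R) (f : Om -> R) : \bar R :=
  ereal_inf [set y | exists f0 f1 : Om -> R,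
    [/\ measurable_fun [set: Om] f0, measurable_fun [set: Om] f1,
        f = (f0 \+ f1)%R
      & y = 'N[mu]_(gamma%:E)[EFin \o f0] + 'N[mu]_(+oo)[EFin \o f1]]].

Definition gradient (R : realType) (d : measure_display)
    (Om : metricMeasurableType R d) (mu : {measure set Om -> \bar R})
    (alpha : R) (f : Om -> R) (rho : R) (x : Om) : \bar R :=
  ((mu (ball x rho))^-1 *
   \int[mu]_(y in ball x rho) (`|f x - f y| `^ alpha)%R%:E) `^ alpha^-1.

Definition besov (R : realType) (d : measure_display)
    (Om : metricMeasurableType R d) (mu : {measure set Om -> \bar R})
    (p : R) (r : \bar R) (beta : R) (alpha s : R) (q : \bar R)
    (f : Om -> R) : \bar R :=
  norm_dlog q (fun rho =>
    (rho `^ (- s))%R%:E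
    * lorentz_zygmund mu p r beta (gradient mu alpha f rho)).

Definition besov_exponent (R : realType) (p : R) (r : \bar R) (beta : R)
    (alpha : R) : Prop :=
  let small := (p%:E < r /\ (p <= 1)%R) \/
               [/\ p%:E = r, (p <= 1)%R & (beta < 0)%R] in
  [/\ (0 < alpha <= 1)%R,
      small -> (alpha < p)%R
    & ~ small -> alpha = min1 r].

Definition le_on_measurable (R : realType) (d : measure_display)
    (Om : measurableType d) (c : R) (A B : (Om -> R) -> \bar R) : Prop :=
  forall f : Om -> R, measurable_fun [set: Om] f -> A f <= c%:E * B f.

Definition preceq (R : realType) (d : measure_display)
    (Om : measurableType d) (A B : (Om -> R) -> \bar R) : Prop :=
  exists2 c : R, (0 < c)%R & le_on_measurable c A B.

(* Main.v *)
Require Import Defs.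
From mathcomp Require Import all_boot all_order all_algebra.
From mathcomp Require Import all_classical all_reals all_analysis.
From mathcomp Require Import measurable_realfun ess_sup_inf ring lra.
Import Order.TTheory GRing.Theory Num.Theory.
Import numFieldNormedType.Exports.

(** Let [N] be the doubling constant, so that [N = 2^Q]. Doubling and
    non-collapsing give [mu (B(x, rho)) >= 2 t] as soon as [rho <= 1] and
    [t] is a small multiple of [rho^Q]. If [|f| > sigma] only on a set of
    measure at most [t], then [|f| <= sigma] on at least half of [B(x, rho)],
    and averaging [|f x - f y|^alpha] over that half gives, at every point,
    [|f x| <= sigma + 2^(1/alpha) * grad_rho f x]. Passing to rearrangements,
      [f^* u - f^* t <= 2^(1/alpha) * (grad_rho f)^* u]
    ([rearrangement_increment]). The Lorentz-Zygmund norm dominates its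
    weak-type version ([lorentz_zygmund_ge]), so along the geometric grid
    [t_k = tau / N^k], with [F_k = f^* t_k], the Besov norm controls the [l^q]
    norm of
      [kappa^k * (1 + k)^beta * (F_(k+1) - F_k)],  [kappa = 2^(s - Q/p)]
    ([besov_sum_ge], [besov_sup_ge]), while [F_0] is controlled by the norm of
    [f] in [L^gamma + L^oo] ([rearrangement_le_sum_norm]).

    What remains are weighted Hardy inequalities that recover [F] from its
    increments. They come from one summation by parts in which the term
    containing [F] itself is absorbed ([discrete_hardy]); it is applied to the
    powers [F_k^a] with [a <= 1], whose increments are at most
    [(F_(k+1) - F_k)^a]. When [s < Q/p] the weights decay geometrically
    ([kappa < 1]). When [s = Q/p] one has [kappa = 1], and the summed weights
    are powers of [1 + k], or of [1 + ln (1 + k)] in the limiting case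
    [beta = 1/m - 1/q]; here [a] is [m = min(1, r)], the exponent [alpha], or
    [q] when [q <= 1]. For [q = +oo] the increments are simply added up
    ([discrete_sup]).

    Two points of measure theory. The measure of a level set is monotone only
    among measurable sets, so the gradient must be measurable in [x]
    ([measurable_oscillation]). The norms in the radius and in [t], on the
    other hand, are compared with step functions on geometric cells, through
    the monotonicity of the integral as a supremum over simple functions
    ([le_lower_integral]). *)

Local Open Scope classical_set_scope.
Local Open Scope ring_scope.

(** * Power inequalities and a discrete Hardy inequality *)

Lemma le_powR {R : realType} (e x y : R) :
  0 <= e -> 0 <= x -> x <= y -> x `^ e <= y `^ e.
Proof.
by move=> e0 x0 xy; rewrite ge0_ler_powR ?nnegrE//; exact: le_trans xy.
Qed.

Lemma le_poweR {R : realType} (e : R) (x y : \bar R) : 0 <= e ->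
  (0 <= x)%E -> (x <= y)%E -> (x `^ e <= y `^ e)%E.
Proof.
move=> e0 x0 xy; apply: gt0_ler_poweR => //; rewrite in_itv/= leey andbT//.
exact: le_trans xy.
Qed.

Lemma powRV {R : realType} (x y : R) : 0 <= x -> x^-1 `^ y = (x `^ y)^-1.
Proof. by move=> x0; rewrite -powR_inv1// powRAC powR_inv1// powR_ge0. Qed.

(** Each of [x] and [y] is a fraction [z] of [x + y], and [z <= z^a] on [[0, 1]]. *)
Lemma powR_subadditive {R : realType} (a x y : R) :
  0 < a <= 1 -> 0 <= x -> 0 <= y -> (x + y) `^ a <= x `^ a + y `^ a.
Proof.
move=> /andP[a0 a1] x0 y0.
have [xy0|xyN0] := eqVneq (x + y) 0.
  by rewrite xy0 powR0 ?gt_eqF// addr_ge0// powR_ge0.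
have xy : 0 < x + y by rewrite lt_neqAle eq_sym xyN0 addr_ge0.
have part z : 0 <= z <= x + y -> z / (x + y) * (x + y) `^ a <= z `^ a.
  move=> /andP[z0 zxy]; have [->|zN0] := eqVneq z 0.
    by rewrite !mul0r powR_ge0.
  have zp : 0 < z by rewrite lt_neqAle eq_sym zN0.
  have zE : z = z / (x + y) * (x + y) by rewrite divfK.
  rewrite [leRHS](_ : _ = (z / (x + y)) `^ a * (x + y) `^ a); last first.
    by rewrite -powRM ?divr_ge0 ?ltW// divfK.
  rewrite ler_wpM2r ?powR_ge0// ger1_powR// divr_gt0//=.
  by rewrite ler_pdivrMr// mul1r.
have := lerD (part x _) (part y _).
rewrite -mulrDl -mulrDl divff// mul1r; apply; first by rewrite x0 lerDl.
by rewrite y0 lerDr.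
Qed.

(** Young's inequality [a * b^(P - 1) <= a^P / P + b^P * (P - 1) / P], rearranged. *)
Lemma powR_increment_le {R : realType} (P a b : R) :
  1 <= P -> 0 <= a <= b -> b `^ P - a `^ P <= P * b `^ (P - 1) * (b - a).
Proof.
move=> P1 /andP[a0 ab]; have P0 : 0 < P by exact: lt_le_trans P1.
have b0 : 0 <= b by exact: le_trans ab.
have [->|PN1] := eqVneq P 1; first by rewrite subrr powRr0 !powRr1// !mul1r.
have PP : 0 < P - 1 by rewrite subr_gt0 lt_neqAle eq_sym PN1.
have /= := @conjugate_powR R a (b `^ (P - 1)) P (P / (P - 1)) a0 (powR_ge0 _ _).
rewrite divr_gt0// => /(_ P0 isT) H.
have {}H := H _.
have e1 : P^-1 + (P / (P - 1))^-1 = 1 by rewrite invf_div; field; rewrite gt_eqF.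
have := H e1; rewrite -powRrM mulrC.
have -> : (P - 1) * (P / (P - 1)) = P by field; rewrite gt_eqF.
move=> {}H.
have bP : b `^ (P - 1) * b = b `^ P by rewrite mulrC mulr_powRB1.
have : P * (b `^ (P - 1) * a) <= a `^ P + (P - 1) * b `^ P.
  apply: le_trans (ler_wpM2l (ltW P0) H) _.
  rewrite le_eqVlt; apply/orP; left; apply/eqP; field.
  by rewrite !gt_eqF.
rewrite -bP; set c := b `^ (P - 1); set d := a `^ P; nra.
Qed.

(** A weighted Young inequality: either [2 P U h <= v A], and half of the term
    [v A^P] is enough, or [A < 2 P U h / v], and [A] can be eliminated. *)
Lemma young_absorb {R : realType} (P U v A h : R) :
  1 <= P -> 0 <= U -> 0 < v -> 0 <= A -> 0 <= h ->
  P * U * A `^ (P - 1) * h <=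
  2^-1 * v * A `^ P + (2 * P) `^ P * (U `^ P * v `^ (1 - P) * h `^ P).
Proof.
move=> P1 U0 v0 A0 h0; have P0 : 0 < P by exact: lt_le_trans P1.
have [P0' v0'] := (ltW P0, ltW v0).
have AP : A `^ (P - 1) * A = A `^ P by rewrite mulrC mulr_powRB1.
have [le1|/ltW le2] := leP (P * U * h) (2^-1 * v * A).
  apply: (@le_trans _ _ (2^-1 * v * A `^ P)); last first.
    by rewrite lerDl !mulr_ge0// ?powR_ge0.
  rewrite -AP [leLHS](_ : _ = P * U * h * A `^ (P - 1)); last by ring.
  rewrite [leRHS](_ : _ = 2^-1 * v * A * A `^ (P - 1)); last by ring.
  by rewrite ler_wpM2r ?powR_ge0.
pose w := 2 * P * U * h / v.
have w0 : 0 <= w by rewrite divr_ge0// ?mulr_ge0.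
have Aw : A <= w.
  rewrite ler_pdivlMr//; lra.
apply: (@le_trans _ _ ((2 * P) `^ P * (U `^ P * v `^ (1 - P) * h `^ P))); last first.
  by rewrite lerDr !mulr_ge0 ?powR_ge0// ltW.
have wP : (2 * P) `^ P * (U `^ P * v `^ (1 - P) * h `^ P) = w `^ P * v.
  rewrite /w !powRM ?mulr_ge0 ?invr_ge0//.
  rewrite -[v^-1]powR_inv1// -powRrM.
  have -> : v `^ (1 - P) = v `^ (-1 * P) * v.
    rewrite -[X in _ = _ * X]powRr1// -powRD ?(gt_eqF v0) ?implybT//.
    by congr (_ `^ _); ring.
  ring.
rewrite wP -(@mulr_powRB1 _ w)//.
apply: (@le_trans _ _ (P * U * h * w `^ (P - 1))).
  rewrite mulrAC ler_wpM2l ?mulr_ge0//.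
  by rewrite ge0_ler_powR ?nnegrE ?subr_ge0.
rewrite [leRHS]mulrAC ler_wpM2r ?powR_ge0//.
rewrite /w divfK ?gt_eqF//.
have : 0 <= P * U * h by rewrite !mulr_ge0.
lra.
Qed.

(** Since [v] is at most the decrement of [U], summation by parts turns
    [sum v_k F_(k+1)^q] into [sum U_k (F_(k+1)^q - F_k^q)]. With [A = F^a] and
    [P = q / a], the increment of [A^P] is at most [P A^(P-1)] times that of
    [A], and [young_absorb] splits the product so that half of the original
    sum moves to the left. *)
Lemma discrete_hardy {R : realType} (q a : R) (U v F : nat -> R) :
  0 < a <= 1 -> a <= q ->
  (forall k, 0 <= U k) -> (forall k, 0 < v k) ->
  (forall k, v k <= U k - U k.+1) ->
  (forall k, 0 <= F k <= F k.+1) ->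
  forall K,
  \sum_(k < K) v k * F k.+1 `^ q <=
  2 * U 0%N * F 0%N `^ q + 2 * (2 * (q / a)) `^ (q / a) *
    \sum_(k < K) U k `^ (q / a) * v k `^ (1 - q / a) * (F k.+1 - F k) `^ q.
Proof.
move=> /andP[a0 a1] aq U0 v0 Uv F0.
set P := q / a; set C := (2 * P) `^ P.
have P1 : 1 <= P by rewrite /P ler_pdivlMr// mul1r.
have P0 : 0 < P by exact: lt_le_trans P1.
have qE : a * P = q by rewrite /P mulrC divfK// gt_eqF.
pose r k := U k `^ P * v k `^ (1 - P) * (F k.+1 - F k) `^ q.
have Fk k : 0 <= F k by case/andP: (F0 k).
have FS k : F k <= F k.+1 by case/andP: (F0 k).
have step k : 2^-1 * v k * F k.+1 `^ q + U k.+1 * F k.+1 `^ q <=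
    U k * F k `^ q + C * r k.
  pose A k := F k `^ a.
  have AE j : F j `^ q = A j `^ P by rewrite -qE powRrM.
  have Aj j : 0 <= A j by rewrite powR_ge0.
  have AS : A k <= A k.+1 by rewrite ge0_ler_powR ?nnegrE// ltW.
  have AD : A k.+1 - A k <= (F k.+1 - F k) `^ a.
    rewrite lerBlDl.
    have := @powR_subadditive R a (F k) (F k.+1 - F k).
    by rewrite addrCA subrr addr0; apply => //; rewrite ?subr_ge0 ?a0.
  have i1 := @powR_increment_le R P (A k) (A k.+1) P1.
  rewrite Aj AS in i1; have {i1} := ler_wpM2l (U0 k) (i1 isT) => i1.
  have i2 := @young_absorb R P (U k) (v k) (A k.+1) (A k.+1 - A k) P1 (U0 k)
    (v0 k) (Aj _).
  rewrite subr_ge0 in i2; have {}i2 := i2 AS.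
  have i3 : (A k.+1 - A k) `^ P <= (F k.+1 - F k) `^ q.
    rewrite -qE powRrM ge0_ler_powR ?nnegrE ?powR_ge0 ?subr_ge0// ltW//.
  have i4 := ler_wpM2r (powR_ge0 (A k.+1) P) (Uv k).
  rewrite !AE /r.
  have i5 : C * (U k `^ P * v k `^ (1 - P) * (A k.+1 - A k) `^ P) <=
            C * (U k `^ P * v k `^ (1 - P) * (F k.+1 - F k) `^ q).
    by rewrite ler_wpM2l ?powR_ge0// ler_wpM2l// mulr_ge0// powR_ge0.
  have lin : forall X Y W V t z z' : R, X - Y <= t -> t <= 2^-1 * V + z ->
    V <= X - W -> z <= z' -> 2^-1 * V + W <= Y + z'.
    by clear; move=> *; lra.
  rewrite mulrBr in i1; rewrite mulrBl in i4; rewrite -[2^-1 * _ * _]mulrA in i2.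
  rewrite -[2^-1 * _ * _]mulrA; apply: (lin _ _ _ _ _ _ _ i1 _ i4 i5).
  apply: (le_trans _ i2); rewrite le_eqVlt; apply/orP; left; apply/eqP; ring.
(* The step says that [U_k F_k^q] plus the partial sums telescopes. *)
have tele K : \sum_(k < K) (2^-1 * v k * F k.+1 `^ q) + U K * F K `^ q <=
    U 0%N * F 0%N `^ q + C * \sum_(k < K) r k.
  elim: K => [|K IH]; first by rewrite !big_ord0 add0r mulr0 addr0.
  rewrite !big_ord_recr/= mulrDr addrA.
  have := step K; move: IH; lra.
move=> K; have := tele K.
have -> : \sum_(k < K) 2^-1 * v k * F k.+1 `^ q = 2^-1 * \sum_(k < K) v k * F k.+1 `^ q.
  by rewrite big_distrr/=; apply: eq_bigr => i _; rewrite mulrA.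
have : 0 <= U K * F K `^ q by rewrite mulr_ge0// powR_ge0.
rewrite /r; set s1 := \sum_(k < K) _; set s2 := \sum_(k < K) _.
lra.
Qed.

(** The increments of [F^a] are at most [M^a] times those of [Z], hence
    [F^a <= F_0^a + M^a Z]; as [Z >= Z_0], the first term is also a multiple of
    [Z]. *)
Lemma discrete_sup {R : realType} (a M : R) (w Z F : nat -> R) :
  0 < a <= 1 -> 0 <= M -> 0 < Z 0%N -> (forall k, 0 <= w k) ->
  (forall k, w k `^ a <= Z k.+1 - Z k) ->
  (forall k, 0 <= F k <= F k.+1) ->
  (forall k, F k.+1 - F k <= M * w k) ->
  forall k, F k <= (1 + (Z 0%N)^-1) `^ a^-1 * (F 0%N + M) * Z k `^ a^-1.
Proof.
move=> /andP[a0 a1] M0 Z0 w0 wZ F0 FM k.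
have Fk j : 0 <= F j by case/andP: (F0 j).
have FS j : F j <= F j.+1 by case/andP: (F0 j).
have ZS j : Z j <= Z j.+1.
  by rewrite -subr_ge0 (le_trans _ (wZ j))// powR_ge0.
have Zk j : Z 0%N <= Z j by elim: j => // j IH; rewrite (le_trans IH).
have step : F k `^ a <= F 0%N `^ a + M `^ a * (Z k - Z 0%N).
  elim: k => [|k IH]; first by rewrite subrr mulr0 addr0.
  have := @powR_subadditive R a (F k) (F k.+1 - F k).
  rewrite addrCA subrr addr0 a0 a1 subr_ge0 => /(_ isT (Fk k) (FS k)) h1.
  have h2 : (F k.+1 - F k) `^ a <= M `^ a * w k `^ a.
    by rewrite -powRM// ge0_ler_powR ?nnegrE ?subr_ge0 ?mulr_ge0// ltW.
  have h3 : M `^ a * w k `^ a <= M `^ a * (Z k.+1 - Z k).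
    by rewrite ler_wpM2l ?powR_ge0.
  lra.
have FMa : F 0%N `^ a <= (F 0%N + M) `^ a.
  by rewrite ge0_ler_powR ?nnegrE ?addr_ge0 ?lerDl// ltW.
have MFa : M `^ a <= (F 0%N + M) `^ a.
  by rewrite ge0_ler_powR ?nnegrE ?addr_ge0 ?lerDr// ltW.
have Zi : 0 <= (Z 0%N)^-1 by rewrite invr_ge0 ltW.
have Zp : 0 < Z k by exact: lt_le_trans (Zk k).
have bnd : F k `^ a <= (1 + (Z 0%N)^-1) * (F 0%N + M) `^ a * Z k.
  set G := (F 0%N + M) `^ a in FMa MFa *.
  have G0 : 0 <= G by rewrite powR_ge0.
  have h1 : M `^ a * (Z k - Z 0%N) <= G * Z k.
    apply: (@le_trans _ _ (G * (Z k - Z 0%N))).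
      by rewrite ler_wpM2r// subr_ge0.
    by rewrite ler_wpM2l// gerBl ltW.
  have h2 : F 0%N `^ a <= (Z 0%N)^-1 * G * Z k.
    apply: (le_trans FMa); rewrite mulrAC -[leLHS]mul1r ler_wpM2r//.
    by rewrite mulrC ler_pdivlMr// mul1r.
  lra.
have aK x : 0 <= x -> (x `^ a) `^ a^-1 = x.
  by move=> x0; rewrite -powRrM divff ?gt_eqF// powRr1.
have Z'0 : 0 <= 1 + (Z 0%N)^-1 by rewrite addr_ge0.
have G0 : 0 <= F 0%N + M by rewrite addr_ge0.
rewrite -{1}(aK (F k))// -[in leRHS](aK (F 0%N + M))//.
rewrite -powRM ?powR_ge0// -powRM ?mulr_ge0 ?powR_ge0 ?(ltW Zp)//.
rewrite ge0_ler_powR ?nnegrE ?mulr_ge0 ?powR_ge0 ?invr_ge0 ?(ltW Zp) ?(ltW a0)//.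
Qed.

(** * Admissible pairs of weights *)

(** The weighted Hardy inequality in [l^q], for nondecreasing sequences: the
    weight [w] on the increments controls the weight [v] on the sequence. *)
Definition hardy_pair {R : realType} (q : R) (w v : nat -> R) : Prop :=
  exists2 C : R, 0 < C & forall F : nat -> R, (forall k, 0 <= F k <= F k.+1) ->
    forall K, \sum_(k < K) v k * F k.+1 `^ q <=
      C * (F 0%N `^ q + \sum_(k < K) (w k * (F k.+1 - F k)) `^ q).

(** The counterpart of [hardy_pair] for [q = +oo], where [z] is the growth that
    increments of size [1 / w] allow. *)
Definition sup_pair {R : realType} (w z : nat -> R) : Prop :=
  exists2 C : R, 0 < C & forall (F : nat -> R) (M : R),
    (forall k, 0 <= F k <= F k.+1) -> 0 <= M ->
    (forall k, w k * (F k.+1 - F k) <= M) ->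
    forall k, F k <= C * (F 0%N + M) * z k.

Lemma powR_comparable {R : realType} (c1 c2 b : R) : 0 < c1 -> 
  exists2 K : R, 0 < K & forall x y, 0 < y -> c1 * y <= x <= c2 * y ->
    x `^ b <= K * y `^ b.
Proof.
move=> c10; exists (c1 `^ b + c2 `^ b).
  by rewrite ltr_wpDr ?powR_ge0// powR_gt0.
move=> x y y0 /andP[xl xu].
have x0 : 0 < x by apply: lt_le_trans xl; rewrite mulr_gt0.
have c20 : 0 < c2 by rewrite -(pmulr_lgt0 _ y0) (lt_le_trans x0).
have [b0|b0] := leP 0 b.
  apply: (@le_trans _ _ (c2 `^ b * y `^ b)).
    by rewrite -powRM ?(ltW c20) ?(ltW y0)// ge0_ler_powR ?nnegrE ?mulr_ge0// ltW.
  by rewrite ler_wpM2r ?powR_ge0// lerDr powR_ge0.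
apply: (@le_trans _ _ (c1 `^ b * y `^ b)).
  rewrite -powRM ?(ltW c10) ?(ltW y0)// -[b]opprK !(powRN _ (- b)) lef_pV2 ?posrE
    ?powR_gt0 ?mulr_gt0//.
  by rewrite ge0_ler_powR ?nnegrE ?oppr_ge0// ?mulr_ge0// ltW.
by rewrite ler_wpM2r ?powR_ge0// lerDl powR_ge0.
Qed.

Lemma ln_increment {R : realType} (x y : R) :
  0 < x <= y -> (y - x) / y <= ln y - ln x.
Proof.
move=> /andP[x0 xy]; have y0 : 0 < y by exact: lt_le_trans xy.
have := @le_ln1Dx R (x / y - 1).
rewrite ltrBrDr addNr divr_gt0// addrCA subrr addr0 ln_div ?posrE// => /(_ isT).
rewrite mulrBl divff ?gt_eqF//; lra.
Qed.

(** [exp z >= 1 + z] for [z = e * ln (y / x)]. *)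
Lemma powR_ratio_ge {R : realType} (x y e : R) :
  0 < x <= y -> 0 < e -> 1 + e * ((y - x) / y) <= (y / x) `^ e.
Proof.
move=> /andP[x0 xy] e0; have y0 : 0 < y by exact: lt_le_trans xy.
rewrite /powR gt_eqF ?divr_gt0// ln_div ?posrE//.
apply: le_trans (expR_ge1Dx _); rewrite lerD2l ler_pM2l//.
by rewrite ln_increment// x0.
Qed.

Lemma powR_increment_ge {R : realType} (x y e : R) :
  0 < x <= y -> y <= 2 * x -> 0 < e ->
  e / 2 * x `^ (e - 1) * (y - x) <= y `^ e - x `^ e.
Proof.
move=> xy y2 e0; have := powR_ratio_ge x y e xy e0.
move/andP: xy => [x0 xy]; have y0 : 0 < y by exact: lt_le_trans xy.
move=> H; have := ler_wpM2r (powR_ge0 x e) H.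
rewrite -powRM ?divr_ge0 ?(ltW x0) ?(ltW y0)// divfK ?gt_eqF//.
rewrite mulrDl mul1r -lerBrDl; apply: le_trans.
rewrite -(@mulr_powRB1 _ x e) ?(ltW x0)//.
rewrite [leLHS](_ : _ = (y - x) * (e * x `^ (e - 1)) * 2^-1); last by ring.
rewrite [leRHS](_ : _ = (y - x) * (e * x `^ (e - 1)) * (x / y)); last by ring.
rewrite ler_wpM2l ?mulr_ge0 ?powR_ge0 ?subr_ge0 ?(ltW e0)//.
by rewrite ler_pdivlMr// mulrC ler_pdivrMr// mulrC.
Qed.

Lemma powR_decrement_ge {R : realType} (x y e : R) :
  0 < x <= y -> y <= 2 * x -> 0 < e ->
  e * 2 `^ (- (e + 1)) * x `^ (- (e + 1)) * (y - x) <= x `^ (- e) - y `^ (- e).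
Proof.
move=> xy y2 e0; have := powR_ratio_ge x y e xy e0.
move/andP: xy => [x0 xy]; have y0 : 0 < y by exact: lt_le_trans xy.
move=> H; have := ler_wpM2r (powR_ge0 y (- e)) H.
rewrite powRM ?invr_ge0 ?(ltW x0) ?(ltW y0)// powRV ?(ltW x0)// -powRN mulrAC -powRD;
  last first.
  by rewrite (gt_eqF y0) implybT.
rewrite subrr powRr0 mul1r mulrDl mul1r -lerBrDl; apply: le_trans.
rewrite [leRHS](_ : _ = e * (y - x) * y `^ (- (e + 1))); last first.
  rewrite opprD powRD ?(gt_eqF y0) ?implybT// powR_inv1 ?(ltW y0)//; ring.
rewrite [leLHS](_ : _ = e * (y - x) * (2 * x) `^ (- (e + 1))); last first.
  by rewrite powRM ?(ltW x0)//; ring.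
rewrite ler_wpM2l ?mulr_ge0 ?(ltW e0) ?subr_ge0//.
have e1 : 0 < e + 1 by rewrite addr_gt0.
rewrite !(powRN _ (e + 1)) lef_pV2 ?posrE ?powR_gt0 ?mulr_gt0//.
by rewrite ge0_ler_powR ?nnegrE ?(ltW e1) ?(ltW y0) ?mulr_ge0 ?(ltW x0).
Qed.

Lemma natS_gt0 {R : realType} k : 0 < 1 + k%:R :> R.
Proof. by rewrite ltr_pwDl. Qed.
Arguments natS_gt0 {R}.

Lemma natS_double {R : realType} k : 1 + k.+1%:R <= 2 * (1 + k%:R) :> R.
Proof. by rewrite -natr1; have := ler0n R k; lra. Qed.

Lemma natS_le {R : realType} k : 0 < (1 + k%:R : R) <= 1 + k.+1%:R.
Proof. by rewrite natS_gt0 lerD2l ler_nat leqnSn. Qed.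

Lemma natS_powR_step {R : realType} (b : R) : exists2 K : R, 0 < K &
  forall k, (1 + k%:R) `^ b <= K * (1 + k.+1%:R) `^ b.
Proof.
have [K K0 HK] := @powR_comparable R 2^-1 1 b (ltac:(by rewrite invr_gt0)).
exists K => // k; apply: HK; first exact: natS_gt0.
have := natS_double (R := R) k; have /andP[_] := natS_le (R := R) k.
lra.
Qed.

Lemma hardy_pair_of {R : realType} (q a C : R) (U w v : nat -> R) :
  0 < a <= 1 -> a <= q ->
  (forall k, 0 <= U k) -> (forall k, 0 < v k) -> (forall k, 0 <= w k) ->
  (forall k, v k <= U k - U k.+1) -> 0 < C ->
  (forall k, U k `^ (q / a) * v k `^ (1 - q / a) <= C * w k `^ q) ->
  hardy_pair q w v.
Proof.
move=> aa aq U0 v0 w0 Uv C0 UC.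
set B := 2 * (2 * (q / a)) `^ (q / a).
have B0 : 0 <= B by rewrite mulr_ge0 ?powR_ge0.
exists (1 + 2 * U 0%N + B * C).
  by rewrite -addrA ltr_pwDl// addr_ge0 ?mulr_ge0 ?powR_ge0 ?(ltW C0).
move=> F F0 K; apply: (le_trans (discrete_hardy q a U v F aa aq U0 v0 Uv F0 K)).
set S := \sum_(k < K) (w k * _) `^ q.
have S0 : 0 <= S by apply: sumr_ge0 => k _; rewrite powR_ge0.
have FS k : 0 <= F k.+1 - F k by rewrite subr_ge0; case/andP: (F0 k).
have h : \sum_(k < K) U k `^ (q / a) * v k `^ (1 - q / a) * (F k.+1 - F k) `^ q <= C
  * S.
  rewrite /S big_distrr/=; apply: ler_sum => k _.
  by rewrite powRM// mulrA ler_wpM2r ?powR_ge0.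
have {}h := ler_wpM2l B0 h; rewrite -/B.
apply: (le_trans (lerD (lexx _) h)); rewrite mulrDr.
have f0 : 0 <= F 0%N `^ q by rewrite powR_ge0.
have BC : 0 <= B * C by exact: mulr_ge0 B0 (ltW C0).
have U00 := U0 0%N.
rewrite mulrA lerD// ler_wpM2r//.
  by rewrite addrAC lerDr; exact: addr_ge0.
by rewrite lerDr; apply: addr_ge0; [exact: ler01|exact: mulr_ge0].
Qed.

Lemma sup_pair_of {R : realType} (a : R) (w Z : nat -> R) :
  0 < a <= 1 -> 0 < Z 0%N -> (forall k, 0 < w k) ->
  (forall k, (w k)^-1 `^ a <= Z k.+1 - Z k) ->
  sup_pair w (fun k => Z k `^ a^-1).
Proof.
move=> aa Z0 w0 wZ; exists ((1 + (Z 0%N)^-1) `^ a^-1).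
  by rewrite powR_gt0// addr_gt0// invr_gt0.
move=> F M F0 M0 FM k.
apply: (@discrete_sup _ a M (fun k => (w k)^-1) Z) => //.
  by move=> j; rewrite invr_ge0 ltW.
by move=> j; rewrite ler_pdivlMr// mulrC.
Qed.

(** With [e = q / a - b q - 1 > 0], take [v = (1 + k)^(- e - 1)] and [U] a
    multiple of [(1 + k)^(- e)]; then [U^P v^(1 - P)] is [(1 + k)^(b q)]. *)
Lemma hardy_power {R : realType} (q a b : R) :
  0 < a <= 1 -> a <= q -> b * q < q / a - 1 ->
  hardy_pair q (fun k => (1 + k%:R) `^ b) (fun k => (1 + k%:R) `^ (b * q - q / a)).
Proof.
move=> aa aq bq.
set e := q / a - b * q - 1; have e0 : 0 < e by rewrite /e; lra.
have veE : b * q - q / a = - (e + 1) by rewrite /e; ring.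
set c := e * 2 `^ (- (e + 1)).
have c0 : 0 < c by rewrite mulr_gt0// powR_gt0.
apply: (@hardy_pair_of _ q a (c^-1 `^ (q / a)) (fun k => c^-1 * (1 + k%:R) `^ (- e))
  _ _ aa aq).
- by move=> k; rewrite mulr_ge0 ?powR_ge0// invr_ge0 ltW.
- by move=> k; rewrite powR_gt0// natS_gt0.
- by move=> k; rewrite powR_ge0.
- move=> k; rewrite -mulrBr ler_pdivlMl// veE.
  have := @powR_decrement_ge R (1 + k%:R) (1 + k.+1%:R) e (natS_le k) (natS_double k)
    e0.
  apply: le_trans; rewrite -/c -natr1.
  rewrite [X in _ <= _ * X](_ : _ = 1) ?mulr1; last by ring.
  by rewrite le_eqVlt; apply/orP; left; apply/eqP; ring.
- by rewrite powR_gt0// invr_gt0.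
- move=> k; have k0 := natS_gt0 (R := R) k.
  rewrite powRM; [|by rewrite invr_ge0 (ltW c0)|exact: powR_ge0].
  rewrite -mulrA ler_wpM2l ?powR_ge0//.
  rewrite -!powRrM -powRD ?(gt_eqF k0) ?implybT//.
  rewrite le_eqVlt; apply/orP; left; apply/eqP; congr (_ `^ _).
  by rewrite /e; case/andP: aa => a0 _; field; rewrite gt_eqF.
Qed.

(** In the limiting case powers of this sequence replace those of [1 + k]; the
    outer [1] bounds it away from zero. *)
Definition log_index {R : realType} (k : nat) : R := 1 + ln (1 + k%:R).

Lemma log_index_ge1 {R : realType} k : 1 <= log_index k :> R.
Proof. by rewrite lerDl ln_ge0// lerDl. Qed.

Lemma log_index_increment {R : realType} k :
  (2 * (1 + k%:R))^-1 <= log_index k.+1 - log_index k :> R.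
Proof.
have := @ln_increment R (1 + k%:R) (1 + k.+1%:R) (natS_le k).
have -> : log_index k.+1 - log_index k = ln (1 + k.+1%:R) - ln (1 + k%:R) :> R.
  by rewrite /log_index; ring.
apply: le_trans; rewrite [X in X / _](_ : _ = 1); last by rewrite -natr1; ring.
rewrite mul1r lef_pV2 ?posrE ?mulr_gt0 ?natS_gt0//; exact: natS_double.
Qed.

Lemma log_index_double {R : realType} k : log_index k.+1 <= 2 * log_index k :> R.
Proof.
rewrite /log_index.
have h : ln (1 + k.+1%:R) <= ln 2 + ln (1 + k%:R) :> R.
  by rewrite -lnM ?posrE ?natS_gt0// ler_ln ?posrE ?mulr_gt0 ?natS_gt0// natS_double.
have h2 : ln (2 : R) <= 1.
  by rewrite (_ : 2 = 1 + 1) ?le_ln1Dx// (lt_trans (ltrN10 R)).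
have := @log_index_ge1 R k; rewrite /log_index; lra.
Qed.

Lemma log_index_le {R : realType} k : 0 < (log_index k : R) <= log_index k.+1.
Proof.
rewrite (lt_le_trans _ (log_index_ge1 k))//= -subr_ge0.
by rewrite (le_trans _ (log_index_increment k))// invr_ge0 mulr_ge0// ltW// natS_gt0.
Qed.

(** The limiting case of [hardy_power]: there [e = 0], so [(1 + k)^(- e)] has no
    decrement and is replaced by the power [1 - q / a] of a logarithm. *)
Lemma hardy_log {R : realType} (q a b : R) :
  0 < a <= 1 -> a < q -> b * q = q / a - 1 ->
  hardy_pair q (fun k => (1 + k%:R) `^ b)
    (fun k => ((1 + k%:R) * log_index k `^ (q / a))^-1).
Proof.
move=> aa aq bq; have [a0 a1] := andP aa.
set P := q / a; set e := P - 1.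
have e0 : 0 < e by rewrite /e subr_gt0 ltr_pdivlMr// mul1r.
have eE : P = e + 1 by rewrite /e; ring.
set c := e * 2 `^ (- (e + 1)).
have c0 : 0 < c by rewrite mulr_gt0// powR_gt0.
have l0 k : 0 < log_index k :> R by case/andP: (@log_index_le R k).
have C0 : 0 < 2 / c by rewrite divr_gt0.
apply: (@hardy_pair_of _ q a ((2 / c) `^ (q / a)) (fun k => (2 / c) * log_index k `^
  (- e)) _ _ aa (ltW aq)).
- by move=> k; rewrite mulr_ge0 ?powR_ge0// ltW.
- by move=> k; rewrite invr_gt0 mulr_gt0 ?powR_gt0// natS_gt0.
- by move=> k; rewrite powR_ge0.
- move=> k; rewrite -mulrBr -(invf_div c) ler_pdivlMl ?divr_gt0//.
  have := @powR_decrement_ge R (log_index k) (log_index k.+1) e (log_index_le k)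
    (log_index_double k) e0.
  apply: le_trans; rewrite -/c.
  rewrite [leLHS](_ : _ = c * log_index k `^ (- (e + 1)) * (2 * (1 + k%:R))^-1); last
    first.
    by rewrite -eE powRN !invfM; ring.
  by rewrite ler_wpM2l ?log_index_increment// mulr_ge0 ?powR_ge0// ltW.
- by rewrite powR_gt0.
- move=> k; have k0 := natS_gt0 (R := R) k.
  rewrite powRM; [|exact: ltW|exact: powR_ge0]; rewrite -/P.
  rewrite -mulrA ler_wpM2l ?powR_ge0//.
  rewrite -!powRrM powRV ?mulr_ge0 ?powR_ge0 ?(ltW k0)// -powRN powRM ?powR_ge0 ?(ltW
    k0)// mulrCA -powRrM -powRD; last first.
    by rewrite (gt_eqF (l0 k)) implybT.
  rewrite [- e * P + _](_ : _ = 0) ?powRr0 ?mulr1; last by rewrite eE; ring.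
  by rewrite bq -/P opprB.
Qed.

Lemma ln_grow {R : realType} (K0 : R) k : 0 < K0 ->
  0 <= ln (K0 + k.+1%:R) - ln (K0 + k%:R) <= K0^-1.
Proof.
move=> K00; have k0 := ler0n R k.
have p : 0 < K0 + k%:R by lra.
rewrite subr_ge0 ler_ln ?posrE// -?natr1; [|lra..].
apply/andP; split; first lra.
rewrite -ln_div ?posrE//; last by lra.
have -> : (K0 + (k%:R + 1)) / (K0 + k%:R) = 1 + (K0 + k%:R)^-1.
  by field; rewrite gt_eqF.
apply: (le_trans (le_ln1Dx _)).
  by rewrite (lt_trans (ltrN10 R))// invr_gt0.
by rewrite lef_pV2 ?posrE//; lra.
Qed.

(** The shift [K0] makes the geometric factor dominate the power one from the
    very first index on. *)
Lemma geometric_power_step {R : realType} (x b : R) : 0 < x < 1 ->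
  exists K0 d : R, [/\ 0 < K0, 0 < d < 1 & forall k,
    x ^+ k.+1 * (K0 + k.+1%:R) `^ b <= d * (x ^+ k * (K0 + k%:R) `^ b)].
Proof.
move=> /andP[x0 x1].
set l := - ln x; have l0 : 0 < l by rewrite oppr_gt0 ln_lt0// x0.
set K0 := 1 + 2 * `|b| / l.
have K00 : 0 < K0 by rewrite ltr_pwDl// divr_ge0 ?mulr_ge0// ltW.
set d := expR (- (l / 2)).
exists K0, d; split=> //.
  by rewrite expR_gt0 expR_lt1 oppr_lt0 divr_gt0.
move=> k.
rewrite exprS mulrAC mulrC [leRHS]mulrCA ler_wpM2l ?exprn_ge0 ?(ltW x0)//.
have k0 := ler0n R k.
rewrite /powR !gt_eqF; [|lra..|rewrite -natr1; lra].
rewrite -[x in x * _]lnK ?posrE// -!expRD ler_expR.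
have /andP[g0 g1] := @ln_grow R K0 k K00.
have h : b * (ln (K0 + k.+1%:R) - ln (K0 + k%:R)) <= l / 2.
  apply: (@le_trans _ _ (`|b| * K0^-1)).
    apply: (le_trans (ler_norm _)); rewrite normrM ler_wpM2l//.
    by rewrite ger0_norm.
  rewrite ler_pdivrMr// /K0 mulrDr mulr1.
  rewrite [X in _ <= _ + X](_ : _ = `|b|); last by field; rewrite gt_eqF.
  by rewrite lerDr divr_ge0// ltW.
move: h; rewrite /l mulrBr; lra.
Qed.

Lemma shift_comparable {R : realType} (K0 b : R) : 0 < K0 ->
  exists2 C : R, 0 < C & forall k,
    (K0 + k%:R) `^ b <= C * (1 + k%:R) `^ b /\
    (1 + k%:R) `^ b <= C * (K0 + k%:R) `^ b.
Proof.
move=> K00.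
have i0 : 0 < K0^-1 by rewrite invr_gt0.
have cK : K0 * K0^-1 = 1 by rewrite divff// gt_eqF.
have h : 0 < (1 + K0)^-1 by rewrite invr_gt0 addr_gt0.
have hK : (1 + K0) * (1 + K0)^-1 = 1 by rewrite divff// gt_eqF// addr_gt0.
have [C1 C10 H1] := @powR_comparable R (1 + K0^-1)^-1 (1 + K0) b
  (ltac:(by rewrite invr_gt0 addr_gt0)).
have [C2 C20 H2] := @powR_comparable R (1 + K0)^-1 (1 + K0^-1) b h.
exists (C1 + C2); first by rewrite addr_gt0.
move=> k; have k0 := ler0n R k; have p : 0 < 1 + k%:R :> R by lra.
have p' : 0 < K0 + k%:R by lra.
split.
  apply: (le_trans (H1 _ _ p _)); last by rewrite ler_wpM2r ?powR_ge0// lerDl ltW.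
  rewrite ler_pdivrMl ?addr_gt0//; apply/andP; split; last by nra.
  rewrite mulrDl mul1r mulrDr mulrC cK.
  have : 0 <= k%:R * K0^-1 by rewrite mulr_ge0// ltW.
  nra.
apply: (le_trans (H2 _ _ p' _)); last by rewrite ler_wpM2r ?powR_ge0// lerDr ltW.
rewrite ler_pdivrMl ?addr_gt0//; apply/andP; split; first by nra.
rewrite mulrDl mul1r mulrDr [K0^-1 * K0]mulrC cK.
have : 0 <= K0^-1 * k%:R by rewrite mulr_ge0// ltW.
lra.
Qed.

Lemma hardy_pair_le {R : realType} (q C : R) (w v v' : nat -> R) :
  0 < C -> (forall k, v' k <= C * v k) -> hardy_pair q w v -> hardy_pair q w v'.
Proof.
move=> C0 vv [D D0 H]; exists (C * D); first by rewrite mulr_gt0.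
move=> F F0 K; rewrite -mulrA.
apply: (@le_trans _ _ (C * \sum_(k < K) v k * F k.+1 `^ q)).
  rewrite big_distrr/=; apply: ler_sum => k _.
  by rewrite mulrA ler_wpM2r ?powR_ge0.
by rewrite ler_pM2l// H.
Qed.

Lemma sup_pair_le {R : realType} (C : R) (w z z' : nat -> R) :
  0 < C -> (forall k, z k <= C * z' k) -> sup_pair w z -> sup_pair w z'.
Proof.
move=> C0 zz [D D0 H]; exists (D * C); first by rewrite mulr_gt0.
move=> F M F0 M0 FM k; apply: (le_trans (H F M F0 M0 FM k)).
have F00 : 0 <= F 0%N by case/andP: (F0 0%N).
rewrite -!mulrA ler_pM2l// mulrCA ler_wpM2l// addr_ge0//.
Qed.

(** A weight that decays geometrically is comparable with its own decrement, so
    [U] and [v] are both multiples of [w^q]. *)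
Lemma hardy_geometric {R : realType} (x b q : R) : 0 < x < 1 -> 0 < q ->
  hardy_pair q (fun k => x ^+ k * (1 + k%:R) `^ b)
    (fun k => (x ^+ k * (1 + k%:R) `^ b) `^ q).
Proof.
move=> x01 q0; have x0 : 0 < x by case/andP: x01.
have [K0 [d [K00 /andP[d0 d1] step]]] := @geometric_power_step R x b x01.
have [C C0 cmp] := @shift_comparable R K0 b K00.
pose s k : R := x ^+ k * (K0 + k%:R) `^ b.
have s0 k : 0 < s k by rewrite mulr_gt0 ?exprn_gt0// powR_gt0// ltr_pwDl.
pose w k : R := x ^+ k * (1 + k%:R) `^ b.
have w0 k : 0 < w k by rewrite mulr_gt0 ?exprn_gt0// powR_gt0// natS_gt0.
have sw k : s k <= C * w k.
  rewrite mulrCA ler_wpM2l ?exprn_ge0 ?(ltW x0)//; exact: (cmp k).1.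
have ws k : w k <= C * s k.
  rewrite mulrCA ler_wpM2l ?exprn_ge0 ?(ltW x0)//; exact: (cmp k).2.
have powq y z : 0 <= y -> 0 <= z -> y <= C * z -> y `^ q <= C `^ q * z `^ q.
  move=> y0 z0 yz; rewrite -powRM ?(ltW C0)//.
  by rewrite ge0_ler_powR ?nnegrE ?(ltW q0)// mulr_ge0// ltW.
apply: (@hardy_pair_le R q (C `^ q) w (fun k => s k `^ q)).
- exact: powR_gt0.
- by move=> k; apply: (powq (w k) (s k)); [exact: ltW|exact: ltW|].
pose a := Num.min q 1.
have aa : 0 < a <= 1 by rewrite lt_min q0 ltr01/= ge_min lexx orbT.
have aq : a <= q by rewrite ge_min lexx.
have dq : d `^ q < 1 
  by have := @gt0_ltr_powR R q q0 d 1; rewrite powR1; apply; rewrite ?nnegrE ?(ltW d0).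
pose e := (1 - d `^ q)^-1; have e0 : 0 < e by rewrite invr_gt0 subr_gt0.
apply: (@hardy_pair_of _ q a (e `^ (q / a) * C `^ q) (fun k => e * s k `^ q) _ _ aa aq).
- by move=> k; apply: mulr_ge0; [exact: ltW|exact: powR_ge0].
- by move=> k; exact: powR_gt0.
- by move=> k; exact: ltW.
- move=> k; rewrite -mulrBr ler_pdivlMl ?subr_gt0// mulrBl mul1r lerD2l lerN2.
  rewrite -powRM ?(ltW d0) ?(ltW (s0 _))//.
  rewrite ge0_ler_powR ?nnegrE ?(ltW q0) ?(ltW (s0 _)) ?step//.
  by rewrite mulr_ge0 ?(ltW d0) ?(ltW (s0 _)).
- by rewrite mulr_gt0 ?powR_gt0.
- move=> k; rewrite powRM; [|exact: ltW|exact: powR_ge0].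
  rewrite -!mulrA ler_wpM2l ?powR_ge0// -!powRrM -powRD; last first.
    by rewrite (gt_eqF (s0 k)) implybT.
  rewrite -mulrDr addrCA subrr addr0 mulr1.
  by apply: (powq (s k) (w k)); [exact: ltW|exact: ltW|].
Qed.

Lemma sup_geometric {R : realType} (x b : R) : 0 < x < 1 ->
  sup_pair (fun k => x ^+ k * (1 + k%:R) `^ b)
    (fun k => (x ^+ k * (1 + k%:R) `^ b)^-1).
Proof.
move=> x01; have x0 : 0 < x by case/andP: x01.
have [K0 [d [K00 /andP[d0 d1] step]]] := @geometric_power_step R x b x01.
have [C C0 cmp] := @shift_comparable R K0 b K00.
pose s k : R := x ^+ k * (K0 + k%:R) `^ b.
have s0 k : 0 < s k by rewrite mulr_gt0 ?exprn_gt0// powR_gt0// ltr_pwDl.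
pose w k : R := x ^+ k * (1 + k%:R) `^ b.
have w0 k : 0 < w k by rewrite mulr_gt0 ?exprn_gt0// powR_gt0// natS_gt0.
have sw k : s k <= C * w k.
  rewrite mulrCA ler_wpM2l ?exprn_ge0 ?(ltW x0)//; exact: (cmp k).1.
have ws k : w k <= C * s k.
  rewrite mulrCA ler_wpM2l ?exprn_ge0 ?(ltW x0)//; exact: (cmp k).2.
have inv y z : 0 < y -> 0 < z -> y <= C * z -> z^-1 <= C * y^-1.
  by move=> y0 z0 yz; rewrite ler_pdivlMr// mulrC ler_pdivrMr.
pose e := C / (1 - d); have e0 : 0 < e by rewrite divr_gt0// subr_gt0.
apply: (@sup_pair_le R (e * C) w (fun k => (e * (s k)^-1) `^ 1^-1)).
- by rewrite mulr_gt0.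
- move=> k; rewrite invr1 powRr1; last first.
    by apply: mulr_ge0; [exact: ltW|rewrite invr_ge0 ltW].
  rewrite -mulrA ler_pM2l//; exact: (inv (w k) (s k) (w0 k) (s0 k) (ws k)).
apply: (@sup_pair_of R 1 w (fun k => e * (s k)^-1)).
- by rewrite ltr01 lexx.
- by rewrite mulr_gt0// invr_gt0.
- exact: w0.
- move=> k; rewrite powRr1 ?invr_ge0 ?(ltW (w0 _))// -mulrBr /e -mulrA.
  apply: (le_trans (inv (s k) (w k) (s0 k) (w0 k) (sw k))).
  rewrite ler_pM2l// ler_pdivlMl ?subr_gt0//.
  have h : (s k)^-1 <= d * (s k.+1)^-1.
    by rewrite ler_pdivlMr// mulrC ler_pdivrMr//; exact: step.
  have h2 : (s k)^-1 <= (s k.+1)^-1.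
    by rewrite (le_trans h)// ler_piMl ?invr_ge0 ?(ltW (s0 _)) ?(ltW d1).
  apply: (@le_trans _ _ ((1 - d) * (s k.+1)^-1)).
    by rewrite ler_pM2l// subr_gt0.
  by rewrite mulrBl mul1r lerD2l lerN2.
Qed.

(** The increments [(1 + k)^(- a b)] of [F^a] sum to [(1 + k)^(1 - a b)]. *)
Lemma sup_power {R : realType} (a b : R) : 0 < a <= 1 -> b < a^-1 ->
  sup_pair (fun k => (1 + k%:R) `^ b) (fun k => (1 + k%:R) `^ (a^-1 - b)).
Proof.
move=> aa ba; have [a0 a1] := andP aa.
pose e := 1 - a * b.
have e0 : 0 < e by rewrite subr_gt0 mulrC -ltr_pdivlMr// div1r.
apply: (@sup_pair_le R ((2 / e) `^ a^-1) _ (fun k => (2 / e * (1 + k%:R) `^ e) `^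
  a^-1)).
- by rewrite powR_gt0// divr_gt0.
- move=> k; rewrite powRM; [|by rewrite divr_ge0// ltW|exact: powR_ge0].
  rewrite ler_wpM2l ?powR_ge0// -powRrM /e le_eqVlt; apply/orP; left.
  by apply/eqP; congr (_ `^ _); field; rewrite gt_eqF.
apply: (@sup_pair_of R a _ (fun k => 2 / e * (1 + k%:R) `^ e) aa).
- by rewrite mulr_gt0 ?powR_gt0 ?natS_gt0// divr_gt0.
- by move=> k; rewrite powR_gt0// natS_gt0.
- move=> k; rewrite -mulrBr -(invf_div e) ler_pdivlMl ?divr_gt0//.
  have := @powR_increment_ge R (1 + k%:R) (1 + k.+1%:R) e (natS_le k) (natS_double k)
    e0.
  apply: le_trans; rewrite [X in _ <= _ * X](_ : _ = 1); last by rewrite -natr1; ring.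
  rewrite mulr1 -powRN -powRrM le_eqVlt; apply/orP; left; apply/eqP.
  by congr (_ * _ `^ _); rewrite /e; ring.
Qed.

(** The increments [1 / (1 + k)] of [F^(1/b)] sum to a logarithm. *)
Lemma sup_log {R : realType} (b : R) : 1 <= b ->
  sup_pair (fun k => (1 + k%:R) `^ b) (fun k => log_index k `^ b).
Proof.
move=> b1; have b0 : 0 < b by exact: lt_le_trans b1.
have l0 k : 0 < log_index k :> R by case/andP: (@log_index_le R k).
apply: (@sup_pair_le R (2 `^ b) _ (fun k => (2 * log_index k) `^ (b^-1)^-1)).
- by rewrite powR_gt0.
- by move=> k; rewrite invrK powRM// ltW.
apply: (@sup_pair_of R b^-1 _ (fun k => 2 * log_index k)).
- by rewrite invr_gt0 b0 invf_le1.
- by rewrite mulr_gt0.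
- by move=> k; rewrite powR_gt0// natS_gt0.
- move=> k; rewrite -powRN -powRrM mulNr divff ?gt_eqF// powR_inv1 ?(ltW (natS_gt0
  _))//.
  by rewrite -mulrBr -ler_pdivrMl// -invfM log_index_increment.
Qed.

(** * Integrals with respect to dt/t on geometric cells *)

(** The integral of a nonnegative function is the supremum of those of the simple
    functions below it, so the comparison holds for arbitrary functions. *)
Lemma le_lower_integral {d} {T : measurableType d} {R : realType}
    (mu : {measure set T -> \bar R}) (D : set T) (f g : T -> \bar R) :
  (forall x, D x -> (0 <= f x)%E) -> (forall x, D x -> (f x <= g x)%E) ->
  (\int[mu]_(x in D) f x <= \int[mu]_(x in D) g x)%E.
Proof.
move=> f0 fg; have g0 x : D x -> (0 <= g x)%E.
  by move=> Dx; exact: le_trans (f0 _ Dx) (fg _ Dx).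
rewrite !ge0_integralE//; apply: ereal_sup_le => _ [h /= hf <-].
exists h => //= x; apply: le_trans (hf x) _.
by apply: lee_restrict => y; exact: fg.
Qed.

Definition grid {R : realType} (tau N : R) (k : nat) : R := tau / N ^+ k.
Definition cell {R : realType} (tau N : R) (k : nat) : set R :=
  `[grid tau N k.+1, grid tau N k[%classic.

Section cells.
Context {R : realType} {tau N : R} (tau0 : 0 < tau) (N1 : 1 < N).
Let N0 : 0 < N. Proof. exact: lt_trans N1. Qed.

Lemma grid_gt0 k : 0 < grid tau N k.
Proof. by rewrite divr_gt0// exprn_gt0. Qed.

Lemma div_grid_ge0 a k : 0 <= a -> 0 <= a / grid tau N k.
Proof. by move=> a0; apply: divr_ge0 => //; exact: ltW (grid_gt0 k). Qed.

Lemma gridS k : grid tau N k = N * grid tau N k.+1.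
Proof. by rewrite /grid exprS; field; rewrite !gt_eqF ?exprn_gt0. Qed.

Lemma grid_ltS k : grid tau N k.+1 < grid tau N k.
Proof. by rewrite [ltRHS]gridS ltr_pMl// grid_gt0. Qed.

Lemma grid_le i j : (i <= j)%N -> grid tau N j <= grid tau N i.
Proof.
move=> /subnK <-; elim: (j - i)%N => // m; apply: le_trans.
by rewrite addSn ltW// grid_ltS.
Qed.

Lemma grid_le0 j : grid tau N j <= tau.
Proof. by have := grid_le 0 j (leq0n _); rewrite /grid expr0 divr1. Qed.

Lemma cell_unique i j t : cell tau N i t -> cell tau N j t -> i = j.
Proof.
wlog ij : i j / (i <= j)%N.
  move=> H ti tj; have [ij|/ltnW ji] := leqP i j; first exact: H.
  by apply/esym; exact: H.
rewrite /cell /= !in_itv/= => /andP[i1 i2] /andP[j1 j2].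
move: ij; rewrite leq_eqVlt => /predU1P[//|ij].
by have := lt_le_trans (lt_le_trans j2 (grid_le _ _ ij)) i1; rewrite ltxx.
Qed.

Lemma grid_cvg0 t : 0 < t -> exists k, grid tau N k <= t.
Proof.
move=> t0.
(* Bernoulli's inequality *)
have H n : 1 + n%:R * (N - 1) <= N ^+ n.
  elim: n => [|n IH]; first by rewrite mul0r addr0 expr0.
  rewrite exprS; apply: le_trans (ler_wpM2l (ltW N0) IH).
  have : 0 <= n%:R * ((N - 1) * (N - 1)) by rewrite !mulr_ge0 ?subr_ge0 ?(ltW N1).
  rewrite -natr1; move: (n%:R) => x; lra.
have [n nP] : exists n : nat, tau / t / (N - 1) < n%:R.
  exists (Num.bound (tau / t / (N - 1))); apply: archi_boundP.
  by rewrite !divr_ge0 ?subr_ge0 ?ltW.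
exists n; rewrite ler_pdivrMr ?exprn_gt0// mulrC -ler_pdivrMr//.
apply: le_trans (H n); move: nP; rewrite ltr_pdivrMr ?subr_gt0// => /ltW nP.
by apply: (le_trans nP); rewrite lerDr.
Qed.

Lemma cell_exists t : 0 < t < tau -> exists k, cell tau N k t.
Proof.
move=> /andP[t0 tt].
have ex : exists k, grid tau N k <= t by exact: grid_cvg0.
case: (ex_minnP ex) => -[|k] kt kmin.
  by move: kt; rewrite /grid expr0 divr1 leNgt tt.
exists k; rewrite /cell/= in_itv/= kt/= ltNge; apply/negP => /kmin.
by rewrite ltnn.
Qed.

Lemma cell_measure k :
  lebesgue_measure (cell tau N k) = (grid tau N k - grid tau N k.+1)%:E.
Proof. by rewrite lebesgue_measure_itv/= lte_fin grid_ltS -EFinD. Qed.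

Lemma cell_gt0 k t : cell tau N k t -> 0 < t.
Proof.
by rewrite /cell/= in_itv/= => /andP[+ _]; apply: lt_le_trans (grid_gt0 _).
Qed.

Lemma cell_lt k t : cell tau N k t -> t < tau.
Proof.
by rewrite /cell/= in_itv/= => /andP[_ +]; move/lt_le_trans; apply; exact: grid_le0.
Qed.

Lemma measurable_cell k : measurable (cell tau N k).
Proof. exact: measurable_itv. Qed.

(** Each cell has [dt/t]-measure at least [1 - 1/N]. *)
Lemma int_dlog_ge_cells (D : set R) (h : R -> \bar R) (H : nat -> R) K :
  measurable D -> (forall t, D t -> 0 < t) ->
  (forall k, (k < K)%N -> cell tau N k `<=` D) ->
  (forall t, D t -> (0 <= h t)%E) -> (forall k, 0 <= H k) ->
  (forall k t, (k < K)%N -> cell tau N k t -> ((H k)%:E <= h t)%E) ->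
  (((1 - N^-1) * \sum_(k < K) H k)%:E <= int_dlog D h)%E.
Proof.
move=> mD D0 cD h0 H0 Hh.
pose g k t : \bar R := (H k / grid tau N k * \1_(cell tau N k) t)%:E.
have g0 k t : (0 <= g k t)%E.
  by rewrite lee_fin; apply: mulr_ge0; [exact: div_grid_ge0|rewrite indicE ler0n].
have mg k : measurable_fun D (g k).
  apply/measurable_EFinP; apply: measurable_funM => //.
  by apply: measurable_indic; exact: measurable_cell.
have ig k : (k < K)%N ->
    (\int[lebesgue_measure]_(t in D) g k t = ((1 - N^-1) * H k)%:E)%E.
  move=> kK.
  rewrite (@integralZl_indic _ _ _ lebesgue_measure D mD (fun=> cell tau N k))//;
    last 2 first.
  - by move=> neg; have := div_grid_ge0 _ k (H0 k); rewrite leNgt neg.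
  - exact: measurable_cell.
  rewrite integral_indic//; last exact: measurable_cell.
  rewrite setIidl; last exact: cD.
  rewrite [X in (_ * X)%E](_ : _ = (grid tau N k - grid tau N k.+1)%:E); last exact:
    cell_measure.
  rewrite -EFinM (gridS k); congr EFin.
  have := grid_gt0 k.+1; move: (grid _ _ _) => x x0.
  by field; rewrite !gt_eqF.
apply: (@le_trans _ _ (\int[lebesgue_measure]_(t in D) \sum_(k < K) g k t)%E).
  rewrite ge0_integral_sum//; last by move=> k; exact: mg.
  rewrite (eq_bigr (fun k : 'I_K => ((1 - N^-1) * H k)%:E)); last first.
    by move=> k _; exact: ig.
  by rewrite sumEFin big_distrr.
rewrite /int_dlog; apply: le_lower_integral => [t _|t Dt]; first exact: sume_ge0.
have ti : (0 <= t^-1%:E)%E by rewrite lee_fin invr_ge0 ltW// D0.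
have [[k /= ck]|nck] := pselect (exists k : 'I_K, cell tau N k t); last first.
  rewrite big1; first by apply: mule_ge0 => //; exact: h0.
  move=> k _; rewrite /g indicE memNset ?mulr0//.
  by move=> ck; apply: nck; exists k.
rewrite (bigD1 k)//= big1 ?adde0; last first.
  move=> j jk; rewrite /g indicE memNset ?mulr0// => cj.
  by move/eqP: jk; apply; apply: val_inj; exact: cell_unique cj ck.
rewrite /g indicE mem_set// mulr1 EFinM.
apply: lee_pmul; [by rewrite lee_fin|by rewrite lee_fin invr_ge0 ltW//
  grid_gt0|exact: Hh|].
rewrite lee_fin lef_pV2 ?posrE ?grid_gt0 ?D0//.
by move: ck; rewrite /cell/= in_itv/= => /andP[_ /ltW].
Qed.

(** Each cell has [dt/t]-measure at most [N - 1], and the cells together with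
    [[tau, 1[] cover the domain. *)
Lemma int_dlog_le_cells (h : R -> \bar R) (H : nat -> R) (H1 M : R) :
  tau < 1 -> (forall t, 0 < t < 1 -> (0 <= h t)%E) -> (forall k, 0 <= H k) ->
  0 <= H1 ->
  (forall k t, cell tau N k t -> (h t <= (H k)%:E)%E) ->
  (forall t, tau <= t < 1 -> (h t <= H1%:E)%E) ->
  (forall K, (N - 1) * \sum_(k < K) H k + H1 / tau <= M) ->
  (int_dlog `]0%R, 1%R[ h <= M%:E)%E.
Proof.
move=> t1 h0 H0 H10 hH hH1 HM.
set D : set R := `]0, 1[%classic.
have mD : measurable D by exact: measurable_itv.
pose g k t : \bar R := (H k / grid tau N k.+1 * \1_(cell tau N k) t)%:E.
pose J : set R := `[tau, 1[%classic.
have mJ : measurable J by exact: measurable_itv.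
pose e t : \bar R := (H1 / tau * \1_J t)%:E.
have g0 k t : (0 <= g k t)%E.
  by rewrite lee_fin; apply: mulr_ge0; [exact: div_grid_ge0|rewrite indicE ler0n].
have e0 t : (0 <= e t)%E.
  by rewrite lee_fin mulr_ge0 ?divr_ge0 ?indicE ?ler0n// ltW.
have mg k : measurable_fun D (g k).
  apply/measurable_EFinP; apply: measurable_funM => //.
  by apply: measurable_indic; exact: measurable_cell.
have me : measurable_fun D e.
  apply/measurable_EFinP; apply: measurable_funM => //.
have ig k : (\int[lebesgue_measure]_(t in D) g k t = ((N - 1) * H k)%:E)%E.
  rewrite (@integralZl_indic _ _ _ lebesgue_measure D mD (fun=> cell tau N k))//;
    last 2 first.
  - by move=> neg; have := div_grid_ge0 _ k.+1 (H0 k); rewrite leNgt neg.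
  - exact: measurable_cell.
  rewrite integral_indic//; last exact: measurable_cell.
  rewrite setIidl; last first.
    move=> t ct; rewrite /D/= in_itv/= (cell_gt0 _ _ ct)/=.
    exact: lt_trans (cell_lt _ _ ct) _.
  rewrite [X in (_ * X)%E](_ : _ = (grid tau N k - grid tau N k.+1)%:E); last exact:
    cell_measure.
  rewrite -EFinM (gridS k); congr EFin.
  have := grid_gt0 k.+1; move: (grid _ _ _) => x x0.
  by field; rewrite !gt_eqF.
have ie : (\int[lebesgue_measure]_(t in D) e t <= (H1 / tau)%:E)%E.
  rewrite (@integralZl_indic _ _ _ lebesgue_measure D mD (fun=> J))//; last first.
    by move=> neg; have := divr_ge0 H10 (ltW tau0); rewrite leNgt neg.
  rewrite integral_indic// -[leRHS]mule1; apply: lee_pmul => //.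
    by rewrite lee_fin divr_ge0// ltW.
  apply: (@le_trans _ _ (lebesgue_measure D)).
    by apply: le_measure; rewrite ?inE//; exact: measurableI.
  by rewrite lebesgue_measure_itv/= lte_fin ltr01 oppr0 adde0.
apply: (@le_trans _ _ (\int[lebesgue_measure]_(t in D) (\sum_(k <oo) g k t + e t))%E).
  rewrite /int_dlog; apply: le_lower_integral => t; rewrite /D/= in_itv/= => t01.
    by apply: mule_ge0; [exact: h0|rewrite lee_fin invr_ge0 ltW//; case/andP: t01].
  have t0 : 0 < t by case/andP: t01.
  have ti : (0 <= t^-1%:E)%E by rewrite lee_fin invr_ge0 ltW.
  have [tt|tt] := ltP t tau.
    have [|k ck] := cell_exists t; first by rewrite t0.
    apply: (@le_trans _ _ (g k t)); last first.
      rewrite -[leLHS]adde0; apply: leeD => //.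
      rewrite (@nneseriesD1 R (g ^~ t) k xpredT)//.
      by apply: leeDl; apply: nneseries_ge0 => j _ _; exact: g0.
    rewrite /g indicE mem_set// mulr1 EFinM.
    apply: lee_pmul => //; [exact: h0|exact: hH|].
    rewrite lee_fin lef_pV2 ?posrE ?grid_gt0//.
    by move: ck; rewrite /cell/= in_itv/= => /andP[].
  have t1' : t < 1 by case/andP: t01.
  apply: (@le_trans _ _ (e t)); last first.
    by rewrite -[leLHS]add0e; apply: leeD => //; apply: nneseries_ge0 => j _ _;
      exact: g0.
  rewrite /e indicE mem_set; last by rewrite /J/= in_itv/= tt t1'.
  rewrite mulr1 EFinM; apply: lee_pmul => //; [exact: h0|by apply: hH1; rewrite tt
    t1'|].
  by rewrite lee_fin lef_pV2 ?posrE.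
rewrite ge0_integralD//; last 2 first.
- by move=> t _; apply: nneseries_ge0 => j _ _; exact: g0.
- by apply: ge0_emeasurable_sum => [k t _ _|k _]; [exact: g0|exact: mg].
rewrite integral_nneseries//.
apply: (@le_trans _ _ ((M - H1 / tau)%:E + (H1 / tau)%:E)%E); last by rewrite -EFinD
  subrK.
apply: leeD => //; apply: lime_le; first by apply: is_cvg_nneseries => k _ _; rewrite
  ig lee_fin mulr_ge0// subr_ge0 ltW.
apply: nearW => K; rewrite big_mkord.
rewrite (eq_bigr (fun k : 'I_K => ((N - 1) * H k)%:E)); last first.
  by move=> k _; exact: ig.
rewrite sumEFin lee_fin -big_distrr lerBrDr. exact: HM.
Qed.

End cells.

(** * Rearrangements and the sum space *)

Section rearrangement_bounds.
Context {R : realType} {d : measure_display} {Om : measurableType d}.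
Context {mu : {measure set Om -> \bar R}}.

Lemma rearrangement_ge0 (g : Om -> \bar R) t : (0 <= rearrangement mu g t)%E.
Proof. by apply: le_ereal_inf_tmp => _ [s [s0 _] <-]; rewrite lee_fin. Qed.

Lemma rearrangement_le (g : Om -> \bar R) t u : t <= u ->
  (rearrangement mu g u <= rearrangement mu g t)%E.
Proof.
move=> tu; apply: ereal_inf_le_tmp => _ [s [s0 hs] <-]; exists s => //.
by split=> //; apply: (le_trans hs); rewrite lee_fin.
Qed.

Lemma measurable_gt_abs (f : Om -> R) s : measurable_fun setT f ->
  measurable [set x | (s%:E < `|(EFin \o f) x|)%E].
Proof.
move=> mf; rewrite -[mkset _]setTI; apply: measurable_lte => //.
by apply: measurableT_comp => //; exact/measurable_EFinP.
Qed.

Lemma sum_norm_ge0 (gamma : R) (f : Om -> R) : (0 <= sum_norm mu gamma f)%E.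
Proof.
by apply: le_ereal_inf_tmp => _ [f0 [f1 [_ _ _ ->]]]; rewrite adde_ge0// Lnorm_ge0.
Qed.

(** Split [f = f0 + f1]: off a null set [|f1|] stays below its essential
    supremum, and Chebyshev's inequality bounds the measure of the level set of
    [f0] at the height [t^(-1/gamma)] times its norm; the slack [e] covers the
    case of a vanishing norm. *)
Lemma rearrangement_le_sum_norm (gamma t : R) : (0 < mu setT)%E ->
  0 < gamma -> 0 < t -> forall f : Om -> R,
  (rearrangement mu (EFin \o f) t <=
   (1 + t `^ (- gamma^-1))%:E * sum_norm mu gamma f)%E.
Proof.
move=> muT g0 t0 f; set c := t `^ (- gamma^-1).
have c0 : 0 < c by rewrite powR_gt0.
rewrite -lee_pdivrMl ?addr_gt0//.
apply: le_ereal_inf_tmp => _ [f0 [f1 [mf0 mf1 fE ->]]].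
rewrite lee_pdivrMl ?addr_gt0//.
have := Lnorm_ge0 mu gamma%:E (EFin \o f0); have := Lnorm_ge0 mu +oo%E (EFin \o f1).
case E1 : ('N[mu]_+oo[EFin \o f1])%E => [M| |] // M0; last first.
  by move=> n0; rewrite addey -?ltNye ?(lt_le_trans _ n0)// gt0_muley ?leey// lte_fin
    addr_gt0.
case E0 : ('N[mu]_gamma%:E[EFin \o f0])%E => [A| |] // A0; last first.
  by rewrite addye// gt0_muley ?leey// lte_fin addr_gt0.
rewrite lee_fin in M0; rewrite lee_fin in A0.
apply/lee_addgt0Pr => e e0; rewrite -EFinD.
set s0 := A * c + e.
have s00 : 0 < s0 by rewrite ltr_wpDl// mulr_ge0// ltW.
apply: (@le_trans _ _ (M + s0)%:E); last first.
  by rewrite lee_fin /s0 mulrDl mul1r; nra.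
apply: ereal_inf_lbound; exists (M + s0) => //; split; first by rewrite addr_ge0// ltW.
have mS0 := measurable_gt_abs f0 s0 mf0; have mS1 := measurable_gt_abs f1 M mf1.
have mf : measurable_fun setT f by rewrite fE; exact: measurable_funD.
apply: (@le_trans _ _ (mu [set x | (s0%:E < `|(EFin \o f0) x|)%E] +
                       mu [set x | (M%:E < `|(EFin \o f1) x|)%E])%E).
  apply: le_trans (measureU2 _ _ _) => //.
  apply: le_measure; rewrite ?inE; [exact: measurable_gt_abs|exact: measurableU|].
  move=> x /=; rewrite fE !lte_fin/= => h.
  have := ler_normD (f0 x) (f1 x).
  by have [|h2] := ltP s0 `|f0 x|; [left|right; lra].
have -> : mu [set x | (M%:E < `|(EFin \o f1) x|)%E] = 0%E.
  have := E1; rewrite unlock muT => ess.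
  have /ess_supP : (ess_sup mu (abse \o (EFin \o f1)) <= M%:E)%E by rewrite ess.
  move=> [S [mS muS0 HS]]; apply/eqP; rewrite -measure_le0 -muS0.
  apply: le_measure; rewrite ?inE// => x /= hx; apply: HS => /=.
  by move/(lt_le_trans hx); rewrite ltxx.
rewrite adde0; set V := mu _.
have IA : (\int[mu]_x (`|f0 x| `^ gamma)%:E = (A `^ gamma)%:E)%E.
  have := E0; rewrite unlock => /(congr1 (fun z => z `^ gamma)%E).
  rewrite -poweRrM mulVf ?gt_eqF// poweRe1; first exact.
  by apply: integral_ge0 => x _; exact: poweR_ge0.
have ch : ((s0 `^ gamma)%:E * V <= (A `^ gamma)%:E)%E.
  rewrite -IA -integral_cst//.
  apply: (@le_trans _ _ (\int[mu]_(x in [set x | (s0%:E < `|(EFin \o f0) x|)%E])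
    (`|f0 x| `^ gamma)%:E)%E).
    apply: le_lower_integral => x /=; first by rewrite lee_fin powR_ge0.
    by rewrite lte_fin lee_fin => /ltW h; rewrite ge0_ler_powR ?nnegrE ?(ltW g0)
      ?(ltW s00).
  apply: ge0_subset_integral => //.
  apply/measurable_EFinP.
  apply: (@measurableT_comp _ _ _ _ _ _ (@powR R ^~ gamma) _ (fun y => `|f0 y|)).
    exact: measurable_powR.
  exact: measurableT_comp.
rewrite -lee_pdivlMl ?powR_gt0// in ch; apply: (le_trans ch).
rewrite -EFinM lee_fin ler_pdivrMl ?powR_gt0//.
have -> : s0 `^ gamma * t = (s0 / c) `^ gamma.
  rewrite powRM ?invr_ge0 ?(ltW s00) ?(ltW c0)// powRV ?(ltW c0)//; congr (_ * _).
  by rewrite /c -powRrM mulNr mulVf ?gt_eqF// powR_inv1 ?(ltW t0)// invrK.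
rewrite ge0_ler_powR ?nnegrE ?(ltW g0) ?divr_ge0 ?(ltW s00) ?(ltW c0)//.
by rewrite ler_pdivlMr// /s0 lerDl ltW.
Qed.

End rearrangement_bounds.

(** * Oscillation on balls and the increments of the rearrangement *)

Section balls.
Context {R : realType} {d : measure_display} {Om : metricMeasurableType R d}.
Implicit Types (x y : Om) (r e : R).

Lemma metric_ball_open x r : open (ball x r).
Proof.
rewrite openE => y xy; apply/nbhs_ballP.
move: xy; rewrite ballEmdist/= => xy.
exists (r - mdist x y); first by rewrite /= subr_gt0.
move=> z; rewrite !ballEmdist/= ltrBrDl.
exact: le_lt_trans (metric_triangle _ _ _).
Qed.

Lemma ball_shift x y e r : ball x e y -> ball x (r - e) `<=` ball y r.
Proof.
rewrite ballEmdist/= => xy z; rewrite !ballEmdist/= => xz.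
apply: le_lt_trans (metric_triangle _ x _) _; rewrite metric_sym.
by rewrite -(subrK e r) addrC ltrD.
Qed.

Lemma ball_exhaustion x r : 0 < r ->
  ball x r = \bigcup_n ball x (r - r / n.+2%:R).
Proof.
move=> r0; apply/seteqP; split=> [y|y [n _]]; last first.
  by apply: le_ball; rewrite lerBlDr lerDl divr_ge0// ltW.
rewrite ballEmdist/= => xy.
have e0 : 0 < r - mdist x y by rewrite subr_gt0.
have [n nP] : exists n : nat, r / (r - mdist x y) < n%:R.
  exists (Num.bound (r / (r - mdist x y))); apply: archi_boundP.
  by rewrite divr_ge0 ?(ltW r0) ?(ltW e0).
exists n => //=; rewrite ballEmdist/= ltrBrDl -ltrBrDr.
rewrite ltr_pdivrMr// mulrC -ltr_pdivrMr//; apply: lt_le_trans nP _.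
by rewrite ler_nat -addn2 leq_addr.
Qed.

Context {mu : {measure set Om -> \bar R}} (Hd : doubling_space mu).

Lemma open_measurable_metric (A : set Om) : open A -> measurable A.
Proof. by move=> oA; rewrite (ds_borel Hd); exact: sub_sigma_algebra. Qed.

Lemma measurable_metric_ball x r : measurable (ball x r).
Proof. exact/open_measurable_metric/metric_ball_open. Qed.

(** If [B(x, r - e)] already carries more than [a] of the mass of [g], so does
    [B(y, r)] for [y] within [e] of [x]: the map is lower semicontinuous. *)
Lemma measurable_ball_integral (g : Om -> \bar R) r : 0 < r ->
  measurable_fun setT g -> (forall y, (0 <= g y)%E) ->
  measurable_fun setT (fun x => \int[mu]_(y in ball x r) g y)%E.
Proof.
move=> r0 mg g0; apply: (measurability _ (ErealGenOInfty.measurableE R)).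
move=> _ [_ [a ->] <-]; rewrite setTI; apply: open_measurable_metric.
rewrite openE => x; rewrite /= in_itv/= andbT => ax.
have cvg : (\int[mu]_(y in ball x (r - r / n.+2%:R)) g y)%E @[n --> \oo] -->
    (\int[mu]_(y in ball x r) g y)%E.
  rewrite [in X in _ --> X]ball_exhaustion//.
  apply: (ge0_nondecreasing_set_cvg_integral (F := fun n => ball x (r - r / n.+2%:R))).
  - move=> m n mn; apply/subsetPset; apply: le_ball.
    rewrite lerD2l lerN2 ler_wpM2l ?(ltW r0)// lef_pV2 ?posrE//.
    by rewrite ler_nat.
  - by move=> n; exact: measurable_metric_ball.
  - by move=> n; exact: measurable_funTS.
  - by [].
have [n an] : exists n, (a%:E < \int[mu]_(y in ball x (r - r / n.+2%:R)) g y)%E.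
  apply: contrapT => /forallNP H; move: ax; apply/negP; rewrite -leNgt.
  rewrite -(cvg_lim (@ereal_hausdorff R) cvg).
  apply: lime_le; first by apply/cvg_ex; eexists; exact: cvg.
  by apply: nearW => n; rewrite leNgt; apply/negP; exact: H.
apply/nbhs_ballP; exists (r / n.+2%:R) => /=; first by rewrite divr_gt0.
move=> y xy; rewrite /= in_itv/= andbT; apply: lt_le_trans an _.
apply: ge0_subset_integral => //; [exact: measurable_metric_ball..|exact:
  measurable_funTS|].
exact: ball_shift.
Qed.

Lemma measurable_ball_measure r : 0 < r ->
  measurable_fun setT (fun x => mu (ball x r)).
Proof.
move=> r0; have := @measurable_ball_integral (cst 1%E) r r0 (measurable_cst _).
move=> /(_ (fun _ => lee01)); apply: eq_measurable_fun => x _.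
by rewrite integral_cst ?mul1e//; exact: measurable_metric_ball.
Qed.

Lemma ball_measure_fin x r : 0 < r -> exists2 v : R, 0 < v & mu (ball x r) = v%:E.
Proof.
move=> r0; have /andP[] := ds_ball Hd x r0.
by case: (mu (ball x r)) => // v; rewrite lte_fin => v0 _; exists v.
Qed.

Lemma measurable_powR_dist (f : Om -> R) (a z : R) : measurable_fun setT f ->
  measurable_fun setT (fun y => (`|z - f y| `^ a)%:E).
Proof.
move=> mf; apply/measurable_EFinP.
apply: (@measurableT_comp _ _ _ _ _ _ (@powR R ^~ a) _ (fun y => `|z - f y|)).
  exact: measurable_powR.
by apply: measurableT_comp => //; exact: measurable_funB.
Qed.

(** The triangle inequality [|f x - f y|^a <= |f x - c|^a + |c - f y|^a], for
    rational [c] close to [f x], exhibits the integral as a countable infimum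
    of measurable functions of [x]. *)
Lemma measurable_oscillation (f : Om -> R) (a r : R) :
  measurable_fun setT f -> 0 < a <= 1 -> 0 < r ->
  measurable_fun setT
    (fun x => \int[mu]_(y in ball x r) (`|f x - f y| `^ a)%:E)%E.
Proof.
move=> mf aa r0; have [a0 a1] := andP aa.
(* [c] enumerates the rationals. *)
pose c n : R := if unpickle n is Some z then ratr z else 0.
have mosc z : measurable_fun setT (fun y => (`|z - f y| `^ a)%:E).
  exact: measurable_powR_dist.
have mosc' z : measurable_fun setT (fun y => (`|f y - z| `^ a)%:E).
  by apply: eq_measurable_fun (mosc z) => y _; rewrite distrC.
pose V z x := (\int[mu]_(y in ball x r) (`|z - f y| `^ a)%:E)%E.
pose h n x := (V (c n) x + (`|f x - c n| `^ a)%:E * mu (ball x r))%E.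
have pw0 (z : R) : (0 <= (`|z| `^ a)%:E)%E by rewrite lee_fin powR_ge0.
have mh n : measurable_fun setT (h n).
  apply: emeasurable_funD.
    by apply: measurable_ball_integral => // y; exact: pw0.
  by apply: emeasurable_funM => //; exact: measurable_ball_measure.
have tri z w x : (V z x <= V w x + (`|z - w| `^ a)%:E * mu (ball x r))%E.
  have mB := measurable_metric_ball x r.
  rewrite -integral_cst// -ge0_integralD//; last 2 first.
  - exact: measurable_funTS.
  - by move=> y _; exact: pw0.
  rewrite /V; apply: le_lower_integral => y _; first exact: pw0.
  rewrite -EFinD lee_fin [leRHS]addrC; apply: le_trans (powR_subadditive _ _ _ aa _
    _) => //.
  by rewrite ge0_ler_powR ?nnegrE ?(ltW a0) ?addr_ge0// ler_distD.
have <- : (fun x => einfs (h ^~ x) 0%N) = (fun x => V (f x) x).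
  apply/funext => x; apply/eqP; rewrite eq_le; apply/andP; split; last first.
    by apply: le_ereal_inf_tmp => _ [n _ <-]; rewrite /h; exact: tri.
  apply/lee_addgt0Pr => e e0.
  have [v v0 vE] := ball_measure_fin x r r0.
  (* Moving [f x] by [dl] changes [|f x - c|^a * v] by at most [e / 2]. *)
  pose dl := (e / (2 * v)) `^ a^-1.
  have ev : 0 < e / (2 * v) by rewrite divr_gt0// mulr_gt0.
  have dl0 : 0 < dl by rewrite powR_gt0.
  have [z] : exists z : rat, ratr z \in `]f x, f x + dl[.
    by apply: rat_in_itvoo; rewrite ltrDl.
  rewrite in_itv/= => /andP[z1 z2].
  apply: (@le_trans _ _ (h (pickle z) x)).
    by apply: ereal_inf_lbound; exists (pickle z).
  rewrite /h /c pickleK vE.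
  have hz : `|ratr z - f x| `^ a <= e / (2 * v).
    rewrite -[leRHS](_ : dl `^ a = _); last first.
      by rewrite /dl -powRrM mulVf ?gt_eqF// powRr1 ?(ltW ev).
    rewrite ge0_ler_powR ?nnegrE ?(ltW a0) ?(ltW dl0)//.
    by rewrite ger0_norm ?subr_ge0 ?(ltW z1)// lerBlDl ltW.
  have hz2 : `|ratr z - f x| `^ a * v <= e / 2.
    apply: (@le_trans _ _ (e / (2 * v) * v)); first by rewrite ler_wpM2r// ltW.
    by rewrite invfM mulrA divfK ?gt_eqF.
  apply: (le_trans (leeD (tri _ (f x) _) (lexx _))).
  rewrite -addeA vE -!EFinM -EFinD; apply: leeD2l; rewrite lee_fin [`|f x -
    _|]distrC; lra.
exact: measurable_fun_einfs.
Qed.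

(** Clearing the average and the power [1/a] leaves a comparison of two functions
    whose measurability is known. *)
Lemma gradient_gtP (f : Om -> R) (a r tau : R) x : 0 < a -> 0 < r -> 0 <= tau ->
  (tau%:E < `|gradient mu a f r x|)%E =
  ((tau `^ a)%:E * mu (ball x r) < \int[mu]_(y in ball x r) (`|f x - f y| `^ a)%:E)%E.
Proof.
move=> a0 r0 t0; rewrite gee0_abs ?poweR_ge0// /gradient.
have [v v0 ->] := ball_measure_fin x r r0.
set G := (\int[mu]_(y in _) _)%E.
have G0 : (0 <= G)%E by apply: integral_ge0 => y _; rewrite lee_fin powR_ge0.
rewrite inver gt_eqF// -EFinM mulrC EFinM -lte_pdivlMl//.
set y := (_ * G)%E.
have y0 : (0 <= y)%E by rewrite mule_ge0// lee_fin invr_ge0 ltW.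
rewrite !ltNge; congr negb; apply/idP/idP => H.
  have := gt0_ler_poweR (ltW a0) _ _ H.
  rewrite !in_itv/= !leey !andbT poweR_ge0 lee_fin t0 => /(_ isT isT).
  by rewrite -poweRrM mulVf ?gt_eqF// poweRe1.
have ai : 0 <= a^-1 by rewrite invr_ge0 ltW.
have := gt0_ler_poweR ai _ _ H.
rewrite !in_itv/= !leey !andbT y0 lee_fin powR_ge0 => /(_ isT isT).
by rewrite ?poweR_EFin -powRrM divff ?gt_eqF// powRr1.
Qed.

Lemma measurable_gradient_gt (f : Om -> R) (a r tau : R) :
  measurable_fun setT f -> 0 < a <= 1 -> 0 < r -> 0 <= tau ->
  measurable [set x | (tau%:E < `|gradient mu a f r x|)%E].
Proof.
move=> mf aa r0 t0; have [a0 _] := andP aa.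
rewrite (_ : mkset _ = [set x | ((tau `^ a)%:E * mu (ball x r) <
   \int[mu]_(y in ball x r) (`|f x - f y| `^ a)%:E)%E]); last first.
  by apply/seteqP; split => x /=; rewrite gradient_gtP.
rewrite -[mkset _]setTI; apply: measurable_lte => //.
  by apply: emeasurable_funM => //; exact: measurable_ball_measure.
exact: measurable_oscillation.
Qed.

(** On a ball of measure at least [2 t] the values [|f| <= sigma] fill at least
    half of the ball, hence [f x] differs from half of its neighbours by at
    least [|f x| - sigma]. *)
Lemma gradient_lower (f : Om -> R) (a r t sigma tau : R) x :
  measurable_fun setT f -> 0 < a -> 0 < r -> 0 <= sigma -> 0 <= tau ->
  (mu [set y | (sigma%:E < `|(EFin \o f) y|)%E] <= t%:E)%E ->
  ((2 * t)%:E <= mu (ball x r))%E ->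
  sigma + 2 `^ a^-1 * tau < `|f x| ->
  (tau%:E < `|gradient mu a f r x|)%E.
Proof.
move=> mf a0 r0 s0 tau0 mut tB fx; rewrite gradient_gtP//.
have [v v0 vE] := ball_measure_fin x r r0; rewrite vE.
set S := [set y | (sigma%:E < `|(EFin \o f) y|)%E] in mut.
have mS : measurable S.
  exact: measurable_gt_abs.
set B := ball x r.
have mB : measurable B := measurable_metric_ball x r.
have mBS : measurable (B `\` S) by exact: measurableD.
have hBS : ((v / 2)%:E <= mu (B `\` S))%E.
  have h1 : (mu B <= mu (B `\` S) + t%:E)%E.
    rewrite (measureDI mu mB mS) leeD2l//; apply: le_trans mut.
    by apply: le_measure; rewrite ?inE//; exact: measurableI.
  rewrite vE in h1; rewrite vE lee_fin in tB.
  move: h1 (measure_ge0 mu (B `\` S)).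
  case: (mu (B `\` S)) => [w| |]; [|by move=> _ _; rewrite leey|by []].
  by rewrite -EFinD !lee_fin => h1 _; lra.
set c := (`|f x| - sigma) `^ a.
have w0 : 0 <= 2 `^ a^-1 * tau by rewrite mulr_ge0// powR_ge0.
have pint : ((c * (v / 2))%:E <= \int[mu]_(y in B) (`|f x - f y| `^ a)%:E)%E.
  rewrite EFinM; apply: (@le_trans _ _ (c%:E * mu (B `\` S))%E).
    by rewrite lee_wpmul2l// lee_fin powR_ge0.
  rewrite -integral_cst//; apply: (@le_trans _ _ (\int[mu]_(y in B `\` S) (`|f x - f
    y| `^ a)%:E)%E).
    apply: le_lower_integral => y [_ /= Sy]; first by rewrite lee_fin powR_ge0.
    rewrite lee_fin ge0_ler_powR ?nnegrE ?(ltW a0)//.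
      by rewrite subr_ge0; lra.
    have : `|f y| <= sigma by rewrite leNgt; apply/negP => h; apply: Sy; rewrite /S/=
      lte_fin.
    have := lerB_normD (f x) (- f y); rewrite normrN; lra.
  apply: ge0_subset_integral => //.
  by apply: measurable_funTS; exact: measurable_powR_dist.
apply: lt_le_trans pint; rewrite -EFinM lte_fin mulrA mulrAC ltr_pM2r//.
rewrite ltr_pdivlMr//.
have -> : tau `^ a * 2 = (2 `^ a^-1 * tau) `^ a.
  by rewrite powRM ?powR_ge0// -powRrM mulVf ?gt_eqF// powRr1// mulrC.
rewrite gt0_ltr_powR ?nnegrE//; lra.
Qed.

(** If [sigma] is admissible for [f] at [t] and [tau] for the gradient at [u],
    then [sigma + 2^(1/a) tau] is admissible for [f] at [u], by
    [gradient_lower]. *)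
Lemma rearrangement_increment (f : Om -> R) (a r t u : R) :
  measurable_fun setT f -> 0 < a <= 1 -> 0 < r ->
  (forall x, ((2 * t)%:E <= mu (ball x r))%E) ->
  (rearrangement mu (EFin \o f) u <= rearrangement mu (EFin \o f) t +
    (2 `^ a^-1)%:E * rearrangement mu (gradient mu a f r) u)%E.
Proof.
move=> mf aa r0 tB; have [a0 _] := andP aa.
have p2 : 0 < 2 `^ a^-1 :> R by rewrite powR_gt0.
have main sigma tau : 0 <= sigma -> 0 <= tau ->
    (mu [set x | (sigma%:E < `|(EFin \o f) x|)%E] <= t%:E)%E ->
    (mu [set x | (tau%:E < `|gradient mu a f r x|)%E] <= u%:E)%E ->
    (rearrangement mu (EFin \o f) u <= sigma%:E + (2 `^ a^-1)%:E * tau%:E)%E.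
  move=> s0 t0 hs ht; rewrite -EFinM -EFinD.
  apply: ereal_inf_lbound; exists (sigma + 2 `^ a^-1 * tau) => //; split.
    by rewrite addr_ge0// mulr_ge0// ltW.
  apply: le_trans ht; apply: le_measure; rewrite ?inE.
  - exact: measurable_gt_abs.
  - exact: measurable_gradient_gt.
  - move=> x /=; rewrite lte_fin => fx.
    exact: (gradient_lower f a r t sigma).
have r1 := rearrangement_ge0 (mu := mu) (EFin \o f) t.
have r2 := rearrangement_ge0 (mu := mu) (gradient mu a f r) u.
set X := rearrangement mu _ u in main *.
have main2 sigma : 0 <= sigma ->
    (mu [set x | (sigma%:E < `|(EFin \o f) x|)%E] <= t%:E)%E ->
    (X <= sigma%:E + (2 `^ a^-1)%:E * rearrangement mu (gradient mu a f r) u)%E.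
  move=> s0 hs; rewrite -leeBlDl//; rewrite -lee_pdivrMl//.
  apply: le_ereal_inf_tmp => _ [tau [t0 ht] <-].
  by rewrite lee_pdivrMl// leeBlDl//; exact: main.
move: r2 main2; set Y := rearrangement mu (gradient _ _ _ _) u.
move=> + main2; have [->|Yfin] := eqVneq Y +oo%E.
  by move=> _; rewrite gt0_muley ?lte_fin// addey ?leey// -ltNye; exact: lt_le_trans r1.
move=> r2; have Yf : Y \is a fin_num by rewrite ge0_fin_numE// ltey.
rewrite -leeBlDr ?fin_numM//; apply: le_ereal_inf_tmp => _ [s [s0 hs] <-].
by rewrite leeBlDr ?fin_numM//; exact: main2.
Qed.

End balls.

(** * Doubling constant and non-collapsing *)

Section doubling.
Context {R : realType} {d : measure_display} {Om : metricMeasurableType R d}.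
Context {mu : {measure set Om -> \bar R}} (Hd : doubling_space mu).

Let N : R := C_mu mu.

(** The doubling inequality is closed in the constant, so it passes to the
    infimum. *)
Lemma C_mu_doubling (x : Om) (rho : R) : 0 < rho ->
  (mu (ball x (2 * rho)) <= N%:E * mu (ball x rho))%E.
Proof.
move=> r0; have [v v0 vE] := ball_measure_fin Hd x rho r0.
have [w w0 wE] := ball_measure_fin Hd x (2 * rho) (mulr_gt0 (ltr0Sn R 1) r0).
rewrite vE wE -EFinM lee_fin -ler_pdivrMr//.
apply: lb_le_inf; first exact: (ds_doubling Hd).
move=> C [_ HC]; have := HC x rho r0.
by rewrite vE wE -EFinM lee_fin -ler_pdivrMr.
Qed.

(** If the infimum were [1], all balls around a point would have the measure of
    the unit ball, and the total measure would be finite. *)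
Lemma C_mu_gt1 : mu [set: Om] = +oo%E -> 1 < N.
Proof.
move=> Hinf; rewrite lt_neqAle; apply/andP; split; last first.
  by apply: lb_le_inf; [exact: (ds_doubling Hd)|move=> C [/ltW]].
apply/eqP => N1.
have [x _] : [set: Om] !=set0.
  by apply/set0P/negP => /eqP E0; move: Hinf; rewrite E0 measure0.
have Bk k : (mu (ball x (2 ^+ k)) <= mu (ball x 1))%E.
  elim: k => [|k IH]; first by rewrite expr0.
  rewrite exprS; apply: le_trans IH.
  by have := C_mu_doubling x (2 ^+ k) (exprn_gt0 k (ltr0Sn R 1)); rewrite -N1 mul1e.
have cvg : mu (ball x (2 ^+ k)) @[k --> \oo] --> mu [set: Om].
  have -> : [set: Om] = \bigcup_k ball x (2 ^+ k).
    apply/seteqP; split=> // y _.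
    exists (Num.bound (mdist x y)) => //=; rewrite ballEmdist/=.
    have /lt_le_trans := @archi_boundP R (mdist x y) (mdist_ge0 _ _); apply.
    by rewrite -natrX ler_nat ltnW// ltn_expl.
  apply: nondecreasing_cvg_mu.
  - by move=> k; exact: (measurable_metric_ball Hd).
  - by apply: bigcupT_measurable => k; exact: (measurable_metric_ball Hd).
  - by move=> m n mn; apply/subsetPset; apply: le_ball; rewrite ler_weXn2l// ler1n.
have [v v0 vE] := ball_measure_fin Hd x 1 ltr01.
have : (mu [set: Om] <= mu (ball x 1))%E.
  rewrite -(cvg_lim (@ereal_hausdorff R) cvg).
  apply: lime_le; first by apply/cvg_ex; eexists; exact: cvg.
  exact: nearW.
by rewrite Hinf vE leye_eq.
Qed.

Lemma noncollapsing_ball (b : R) (k : nat) (x : Om) (rho : R) : 1 < N ->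
  (forall y : Om, (b%:E <= mu (ball y 1))%E) -> 0 <= b ->
  grid 1 2 k <= rho -> ((b / N ^+ k)%:E <= mu (ball x rho))%E.
Proof.
move=> N1 Hb b0 krho; have N0 : 0 < N by exact: lt_trans N1.
have le r r' : r <= r' -> (mu (ball x r) <= mu (ball x r'))%E.
  by move=> rr; apply: le_measure; rewrite ?inE; [exact: (measurable_metric_ball
    Hd)..|exact: le_ball].
apply: le_trans (le _ _ krho).
elim: k {krho} => [|k IH]; first by rewrite /grid expr0 !divr1.
rewrite exprS invfM mulrCA EFinM lee_pdivrMl//; apply: (le_trans IH).
have g0 : 0 < grid 1 2 k.+1 :> R by exact: (grid_gt0 ltr01 (ltr1n _ 2)).
have := C_mu_doubling x (grid 1 2 k.+1) g0; apply: le_trans.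
by rewrite -(gridS (ltr1n R 2)).
Qed.

End doubling.

(** * Logarithms on cells and the weak-type bound *)

Lemma gridE_powR {R : realType} (tau N a : R) k : 0 < tau -> 0 < N ->
  grid tau N k `^ a = tau `^ a * (N `^ (- a)) ^+ k.
Proof.
move=> t0 N0; rewrite /grid powRM ?invr_ge0 ?exprn_ge0 ?(ltW t0) ?(ltW N0)//.
congr (_ * _); rewrite powRV ?exprn_ge0 ?(ltW N0)// powRN exprVn; congr (_^-1).
rewrite -powR_mulrn ?(ltW N0)// -[RHS]powR_mulrn ?powR_ge0//.
by rewrite -!powRrM mulrC.
Qed.

Section logarithm_on_cells.
Context {R : realType} {tau N : R} (tau01 : 0 < tau < 1) (N1 : 1 < N).
Let tau0 : 0 < tau. Proof. by case/andP: tau01. Qed.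
Let tau1 : tau < 1. Proof. by case/andP: tau01. Qed.
Let N0 : 0 < N. Proof. exact: lt_trans N1. Qed.

Lemma cell_log : exists c1 c2 : R, [/\ 0 < c1, 0 < c2 & forall k t,
  cell tau N k t -> c1 * (1 + k%:R) <= 1 + ln t^-1 <= c2 * (1 + k%:R)].
Proof.
have lN : 0 < ln N by exact: ln_gt0.
have lt : 0 < ln tau^-1 by rewrite ln_gt0// invf_gt1.
have lg k : ln (grid tau N k)^-1 = ln tau^-1 + k%:R * ln N.
  rewrite /grid invfM invrK lnM ?posrE ?invr_gt0 ?exprn_gt0//.
  by rewrite lnXn// mulr_natl.
exists (Num.min 1 (ln N)), (1 + ln tau^-1 + ln N); split.
- by rewrite lt_min ltr01.
- by rewrite !addr_gt0.
move=> k t ct; have t0 := cell_gt0 tau0 N1 k t ct.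
move: ct; rewrite /cell/= in_itv/= => /andP[t1 t2].
have k0 := ler0n R k.
have h1 : ln (grid tau N k)^-1 <= ln t^-1.
  by rewrite ler_ln ?posrE ?invr_gt0 ?(grid_gt0 tau0 N1)// lef_pV2 ?posrE ?(grid_gt0
    tau0 N1)// ltW.
have h2 : ln t^-1 <= ln (grid tau N k.+1)^-1.
  by rewrite ler_ln ?posrE ?invr_gt0 ?(grid_gt0 tau0 N1)// lef_pV2 ?posrE ?(grid_gt0
    tau0 N1).
rewrite !lg in h1 h2; rewrite -natr1 in h2.
apply/andP; split.
  have m1 : Num.min 1 (ln N) <= 1 by rewrite ge_min lexx.
  have m2 : Num.min 1 (ln N) * k%:R <= ln N * k%:R.
    by rewrite ler_wpM2r// ge_min lexx orbT.
  rewrite mulrDr mulr1; lra.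
have : 0 <= ln tau^-1 * k%:R by rewrite mulr_ge0// ltW.
nra.
Qed.

Lemma cell_log_powR (beta : R) : exists2 K : R, 0 < K & forall k t,
  cell tau N k t -> (1 + ln t^-1) `^ beta <= K * (1 + k%:R) `^ beta /\
                    (1 + k%:R) `^ beta <= K * (1 + ln t^-1) `^ beta.
Proof.
have [c1 [c2 [c10 c20 H]]] := cell_log.
have [K1 K10 H1] := @powR_comparable R c1 c2 beta c10.
have [K2 K20 H2] := @powR_comparable R c2^-1 c1^-1 beta (ltac:(by rewrite invr_gt0)).
exists (K1 + K2); first by rewrite addr_gt0.
move=> k t ct; have /andP[h1 h2] := H k t ct.
have k0 : 0 < 1 + k%:R :> R := natS_gt0 k.
have l0 : 0 < 1 + ln t^-1 by apply: lt_le_trans h1; rewrite mulr_gt0.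
split.
  apply: (le_trans (H1 _ _ k0 _)); first by rewrite h1.
  by rewrite ler_wpM2r ?powR_ge0// lerDl ltW.
apply: (le_trans (H2 _ _ l0 _)); first by rewrite ler_pdivrMl// ler_pdivlMl// h1 h2.
by rewrite ler_wpM2r ?powR_ge0// lerDr ltW.
Qed.

Lemma cell_lt1 k t : cell tau N k t -> t < 1.
Proof. by move=> ct; apply: lt_trans (cell_lt tau0 N1 k t ct) tau1. Qed.

Lemma cell_ln_ge0 k t : cell tau N k t -> 0 <= ln t^-1.
Proof.
move=> ct; rewrite ln_ge0// invf_ge1 ?(cell_gt0 tau0 N1 k t ct)//.
exact: ltW (cell_lt1 _ _ ct).
Qed.

(** The Lorentz-Zygmund norm dominates its weak-type counterpart, whatever the
    second index: on one cell the rearrangement stays above its value at the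
    right end point. *)
Lemma lorentz_zygmund_ge {d} {Om : measurableType d}
    (mu : {measure set Om -> \bar R}) (p beta : R) (r : \bar R) :
  0 < p -> (0 < r)%E ->
  exists2 c : R, 0 < c & forall (g : Om -> \bar R) k a, 0 <= a ->
    (a%:E <= rearrangement mu g (grid tau N k))%E ->
    ((c * ((N `^ (- p^-1)) ^+ k * (1 + k%:R) `^ beta * a))%:E <=
      lorentz_zygmund mu p r beta g)%E.
Proof.
move=> p0 r0; have [K K0 HK] := cell_log_powR beta.
set x := N `^ (- p^-1); have x0 : 0 < x by rewrite powR_gt0.
pose w k : R := x ^+ k * (1 + k%:R) `^ beta.
have w0 k : 0 < w k by rewrite mulr_gt0 ?exprn_gt0 ?powR_gt0// natS_gt0.
pose om t : R := t `^ p^-1 * (1 + Num.max 0 (ln t^-1)) `^ beta.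
pose c0 : R := tau `^ p^-1 * x / K.
have c00 : 0 < c0 by rewrite divr_gt0 ?mulr_gt0 ?powR_gt0.
have om_ge k t : cell tau N k t -> c0 * w k <= om t.
  move=> ct; rewrite /om max_r ?(cell_ln_ge0 _ _ ct)//.
  have [_ h] := HK k t ct.
  have h2 : tau `^ p^-1 * (x * x ^+ k) <= t `^ p^-1.
    rewrite -exprS -gridE_powR// ge0_ler_powR ?nnegrE ?invr_ge0 ?(ltW p0)//.
    - exact: ltW (grid_gt0 tau0 N1 _).
    - exact: ltW (cell_gt0 tau0 N1 k t ct).
    - by move: ct; rewrite /cell/= in_itv/= => /andP[].
  apply: (@le_trans _ _ (tau `^ p^-1 * (x * x ^+ k) * (K^-1 * (1 + k%:R) `^ beta))).
    by rewrite /c0 /w le_eqVlt; apply/orP; left; apply/eqP; ring.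
  apply: ler_pM => //; last by rewrite ler_pdivrMl.
    by rewrite !mulr_ge0 ?powR_ge0 ?exprn_ge0 ?(ltW x0).
  by rewrite mulr_ge0 ?powR_ge0// invr_ge0 ltW.
have om0 t : 0 <= om t by rewrite mulr_ge0 ?powR_ge0.
have low (g : Om -> \bar R) k a t : 0 <= a -> (a%:E <= rearrangement mu g (grid tau N
  k))%E ->
    cell tau N k t -> ((c0 * w k * a)%:E <= (om t)%:E * rearrangement mu g t)%E.
  move=> a0 ga ct; rewrite EFinM; apply: lee_pmul; rewrite ?lee_fin//.
  - exact: ltW (mulr_gt0 c00 (w0 k)).
  - exact: om_ge.
  - apply: (le_trans ga); apply: rearrangement_le.
    by move: ct; rewrite /cell/= in_itv/= => /andP[_ /ltW].
have h0 (g : Om -> \bar R) t : (0 <= (om t)%:E * rearrangement mu g t)%E.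
  by rewrite mule_ge0 ?lee_fin// rearrangement_ge0.
case: r r0 => [r'| |]// r0.
- rewrite lte_fin in r0.
  have e0 : 0 < 1 - N^-1 by rewrite subr_gt0 invf_lt1.
  exists ((1 - N^-1) `^ r'^-1 * c0); first by rewrite mulr_gt0// powR_gt0.
  move=> g k a a0 ga; rewrite /lorentz_zygmund /norm_dlog -/w.
  set I := int_dlog _ _.
  have HI : (((1 - N^-1) * (c0 * w k * a) `^ r')%:E <= I)%E.
    have A0 : 0 <= c0 * w k * a := mulr_ge0 (ltW (mulr_gt0 c00 (w0 k))) a0.
    pose H j : R := if j == k then (c0 * w k * a) `^ r' else 0.
    have <- : \sum_(j < k.+1) H j = (c0 * w k * a) `^ r'.
      rewrite big_ord_recr/= /H eqxx big1 ?add0r// => j _.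
      by rewrite ltn_eqF.
    apply: (int_dlog_ge_cells tau0 N1) => //.
    + by move=> t; rewrite /= in_itv/= andbT.
    + by move=> j _ t ct; rewrite /= in_itv/= andbT (cell_gt0 tau0 N1 j t ct).
    + by move=> t _; exact: poweR_ge0.
    + by move=> j; rewrite /H; case: ifP => _ //; exact: powR_ge0.
    + move=> j t _ ct; rewrite /H; case: ifP => [/eqP jk|_]; last exact: poweR_ge0.
      rewrite jk in ct; rewrite -poweR_EFin.
      by apply: le_poweR; [exact: ltW|rewrite lee_fin|exact: low].
  have ri : 0 <= r'^-1 by rewrite invr_ge0 ltW.
  apply: le_trans (le_poweR _ _ _ ri _ HI); last first.
    by rewrite lee_fin mulr_ge0 ?powR_ge0// ltW.
  have A0 : 0 <= c0 * w k * a := mulr_ge0 (ltW (mulr_gt0 c00 (w0 k))) a0.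
  have E : ((1 - N^-1) * (c0 * w k * a) `^ r') `^ r'^-1 =
      (1 - N^-1) `^ r'^-1 * (c0 * w k * a).
    rewrite (@powRM _ (1 - N^-1)) ?(ltW e0) ?powR_ge0// -powRrM divff ?gt_eqF//.
    by rewrite powRr1.
  by rewrite poweR_EFin E -/(w k) !mulrA.
- exists c0 => // g k a a0 ga; rewrite /lorentz_zygmund /norm_dlog /sup_on.
  pose t := grid tau N k.+1.
  have ct : cell tau N k t.
    by rewrite /cell/= in_itv/= lexx/=; exact: grid_ltS.
  apply: (@le_trans _ _ ((om t)%:E * rearrangement mu g t)%E).
    by have := low g k a t a0 ga ct; rewrite -mulrA.
  apply: ereal_sup_ubound; exists t => //=.
  by rewrite in_itv/= andbT (cell_gt0 tau0 N1 k t ct).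
Qed.

End logarithm_on_cells.

(** * Between Besov norms and sequences *)

Lemma norm_dlog_ge0 {R : realType} (q : \bar R) (h : R -> \bar R) :
  (forall t, 0 < t -> (0 <= h t)%E) -> (0 <= norm_dlog q h)%E.
Proof.
move=> h0; have sup0 : (0 <= sup_on `]0%R, +oo[ h)%E.
  apply: le_ereal_sup_tmp; exists (h 1); last exact: h0.
  by exists 1 => //=; rewrite in_itv/= ltr01.
by case: q => [q| |] //=; exact: poweR_ge0.
Qed.

Section transfer.
Context {R : realType} {d : measure_display} {Om : metricMeasurableType R d}.
Context {mu : {measure set Om -> \bar R}} (Hd : doubling_space mu).
Context (Hinf : mu [set: Om] = +oo%E) {b : R} (b0 : 0 < b).
Context (Hnc : forall y : Om, (b%:E <= mu (ball y 1))%E).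
Context {p : R} {r : \bar R} {beta s alpha gamma : R}.
Context (p0 : 0 < p) (r0 : (0 < r)%E) (s0 : 0 < s).
Context (alpha01 : 0 < alpha <= 1) (gamma0 : 0 < gamma).

Let N : R := C_mu mu.
Let N1 : 1 < N. Proof. exact: C_mu_gt1. Qed.
Let N0 : 0 < N. Proof. exact: lt_trans N1. Qed.

(** The scale of the grid is such that a ball of radius [2^-(k+1)] has at least
    twice the measure [tau / N^k]. *)
Definition grid_scale (b : R) : R := Num.min b 1 / (2 * C_mu mu).
Let tau := grid_scale b.

Lemma grid_scale_itv : 0 < tau < 1.
Proof.
have m0 : 0 < Num.min b 1 by rewrite lt_min b0 ltr01.
rewrite /tau /grid_scale -/N divr_gt0 ?mulr_gt0//= ltr_pdivrMr ?mulr_gt0// mul1r.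
apply: (@le_lt_trans _ _ 1); first by rewrite ge_min lexx orbT.
by apply: lt_trans N1 _; rewrite ltr_pMl// ltr1n.
Qed.
Let tau0 : 0 < tau. Proof. by case/andP: grid_scale_itv. Qed.
Let tau1 : tau < 1. Proof. by case/andP: grid_scale_itv. Qed.

Lemma grid_scale_ball k rho x : grid 1 2 k.+1 <= rho ->
  ((2 * grid tau N k)%:E <= mu (ball x rho))%E.
Proof.
move=> kr; apply: le_trans (noncollapsing_ball Hd b k.+1 x rho N1 Hnc (ltW b0) kr).
rewrite lee_fin /tau /grid_scale -/N /grid.
have -> : 2 * (Num.min b 1 / (2 * N) / N ^+ k) = Num.min b 1 / N ^+ k.+1.
  by rewrite exprS; field; rewrite !gt_eqF ?exprn_gt0.
by rewrite ler_wpM2r ?invr_ge0 ?exprn_ge0 ?(ltW N0)// ge_min lexx.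
Qed.

Let star (f : Om -> R) : R -> \bar R := rearrangement mu (EFin \o f).
Let F (f : Om -> R) k : R := fine (star f (grid tau N k)).
Let kappa : R := 2 `^ s * N `^ (- p^-1).
Let W k : R := kappa ^+ k * (1 + k%:R) `^ beta.

Let kappa0 : 0 < kappa. Proof. by rewrite mulr_gt0// powR_gt0. Qed.
Let W0 k : 0 < W k.
Proof. by rewrite mulr_gt0 ?exprn_gt0 ?powR_gt0// natS_gt0. Qed.

Definition star_fin (f : Om -> R) : Prop :=
  forall k, star f (grid tau N k) \is a fin_num.

Lemma F_nondecreasing f : star_fin f -> forall k, 0 <= F f k <= F f k.+1.
Proof.
move=> ff k; rewrite fine_ge0 ?rearrangement_ge0//= fine_le//.
by apply: rearrangement_le; exact: ltW (grid_ltS tau0 N1 k).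
Qed.

(** On dyadic radii the Besov integrand controls one increment of the
    rearrangement along the grid. *)
Lemma besov_integrand_ge : exists2 c : R, 0 < c & forall f : Om -> R,
  measurable_fun setT f -> star_fin f -> forall k rho, cell 1 2 k rho ->
  ((c * (W k * (F f k.+1 - F f k)))%:E <= (rho `^ (- s))%:E *
     lorentz_zygmund mu p r beta (gradient mu alpha f rho))%E.
Proof.
have [c1 c10 H1] := @lorentz_zygmund_ge R tau N grid_scale_itv N1 _ _ mu p beta r p0 r0.
have [K K0 HK] := @natS_powR_step R beta.
set x := N `^ (- p^-1) in H1; have x0 : 0 < x by rewrite powR_gt0.
set z : R := 2 `^ alpha^-1; have z0 : 0 < z by rewrite powR_gt0.
pose c := c1 * x * K^-1 * z^-1.
have c0 : 0 < c by rewrite !mulr_gt0 ?invr_gt0.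
exists c => // f mf ff k rho crho.
have rho0 : 0 < rho := cell_gt0 ltr01 (ltr1n R 2) k rho crho.
have /andP[r1 r2] : grid 1 2 k.+1 <= rho < grid 1 2 k.
  by move: crho; rewrite /cell/= in_itv.
have /andP[F0 FS] := F_nondecreasing f ff k.
pose a := (F f k.+1 - F f k) / z.
have a0 : 0 <= a by rewrite divr_ge0 ?subr_ge0// ltW.
have ag : (a%:E <= rearrangement mu (gradient mu alpha f rho) (grid tau N k.+1))%E.
  have := rearrangement_increment Hd f alpha rho (grid tau N k) (grid tau N k.+1)
    mf alpha01 rho0 (fun y => grid_scale_ball k rho y r1).
  rewrite -/(star f) -(fineK (ff k.+1)) -(fineK (ff k)) -/(F f k) -/(F f k.+1) -/z.
  move=> h; rewrite /a mulrC EFinM lee_pdivrMl// EFinB leeBlDl//.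
have h1 := H1 _ k.+1 a a0 ag.
have h2 : (2 `^ s) ^+ k <= rho `^ (- s).
  have : grid 1 2 k `^ (- s) <= rho `^ (- s).
    have g0 : 0 < grid 1 2 k :> R := grid_gt0 ltr01 (ltr1n R 2) k.
    rewrite !powRN lef_pV2 ?posrE ?powR_gt0//.
    by rewrite ge0_ler_powR ?nnegrE ?(ltW s0) ?(ltW rho0) ?(ltW g0) ?(ltW r2).
  by rewrite gridE_powR// powR1 mul1r opprK.
have h4 : c * (W k * (F f k.+1 - F f k)) <=
    (2 `^ s) ^+ k * (c1 * (x ^+ k.+1 * (1 + k.+1%:R) `^ beta * a)).
  have h5 : K^-1 * (1 + k%:R) `^ beta <= (1 + k.+1%:R) `^ beta.
    by rewrite ler_pdivrMl.
  have -> : c * (W k * (F f k.+1 - F f k)) =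
      (2 `^ s) ^+ k * (c1 * x ^+ k.+1 * a) * (K^-1 * (1 + k%:R) `^ beta).
    by rewrite /c /W /kappa -/x exprMn exprS /a; ring.
  have -> : (2 `^ s) ^+ k * (c1 * (x ^+ k.+1 * (1 + k.+1%:R) `^ beta * a)) =
      (2 `^ s) ^+ k * (c1 * x ^+ k.+1 * a) * (1 + k.+1%:R) `^ beta by ring.
  apply: ler_wpM2l h5; apply: mulr_ge0; first by apply: exprn_ge0; exact: powR_ge0.
  by apply: mulr_ge0 => //; apply: mulr_ge0; [exact: ltW|apply: exprn_ge0; exact: ltW].
apply: (@le_trans _ _ ((2 `^ s) ^+ k * (c1 * (x ^+ k.+1 * (1 + k.+1%:R) `^ beta *
  a)))%:E).
  by rewrite lee_fin.
rewrite EFinM; apply: lee_pmul.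
- by rewrite lee_fin; apply: exprn_ge0; exact: powR_ge0.
- rewrite lee_fin; apply: mulr_ge0; first exact: ltW.
  apply: mulr_ge0 => //; apply: mulr_ge0; last exact: powR_ge0.
  by apply: exprn_ge0; exact: ltW.
- by rewrite lee_fin.
- exact: h1.
Qed.

Lemma besov_ge0 q f : (0 <= besov mu p r beta alpha s q f)%E.
Proof.
apply: norm_dlog_ge0 => t _; apply: mule_ge0; first by rewrite lee_fin powR_ge0.
apply: norm_dlog_ge0 => u _; apply: mule_ge0; last exact: rearrangement_ge0.
by rewrite lee_fin mulr_ge0 ?powR_ge0.
Qed.

Lemma besov_sum_ge q : 0 < q -> exists2 c : R, 0 < c & forall f : Om -> R,
  measurable_fun setT f -> star_fin f -> forall B : R,
  besov mu p r beta alpha s q%:E f = B%:E -> forall K,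
  \sum_(k < K) (W k * (F f k.+1 - F f k)) `^ q <= c * B `^ q.
Proof.
move=> q0; have [c c0 H] := besov_integrand_ge.
exists (2 * (c `^ q)^-1); first by rewrite mulr_gt0// invr_gt0 powR_gt0.
move=> f mf ff B EB K; have B0 : 0 <= B by have := besov_ge0 q%:E f; rewrite EB lee_fin.
move: EB; rewrite /besov /norm_dlog; set h := (fun rho : R => _ : \bar R); set I :=
  int_dlog _ _.
have I0 : (0 <= I)%E.
  apply: integral_ge0 => t; rewrite /= in_itv/= andbT => t0; apply: mule_ge0.
    exact: poweR_ge0.
  by rewrite lee_fin invr_ge0 ltW.
move=> /(congr1 (fun y => y `^ q)%E).
rewrite -poweRrM mulVf ?gt_eqF// poweRe1// poweR_EFin => IB.
have D0 k : 0 <= F f k.+1 - F f k.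
  by rewrite subr_ge0; case/andP: (F_nondecreasing f ff k).
have WD0 k : 0 <= W k * (F f k.+1 - F f k) by rewrite mulr_ge0// ltW.
have := @int_dlog_ge_cells R 1 2 ltr01 (ltr1n R 2) `]0, +oo[%classic h
  (fun k => (c * (W k * (F f k.+1 - F f k))) `^ q) K.
rewrite -/I IB lee_fin => H2.
have {H2} : (1 - 2^-1) * \sum_(k < K) (c * (W k * (F f k.+1 - F f k))) `^ q <= B `^ q.
  apply: H2 => //.
  - by move=> t; rewrite /= in_itv/= andbT.
  - by move=> k _ t ct; rewrite /= in_itv/= andbT (cell_gt0 ltr01 (ltr1n R 2) k t ct).
  - by move=> t _; exact: poweR_ge0.
  - by move=> k; exact: powR_ge0.
  - move=> k t _ ct; rewrite -poweR_EFin; apply: le_poweR; first exact: ltW.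
      by rewrite lee_fin mulr_ge0// ltW.
    exact: H.
rewrite (eq_bigr (fun k : 'I_K => c `^ q * (W k * (F f k.+1 - F f k)) `^ q)); last
  first.
  by move=> k _; rewrite powRM// ltW.
rewrite -big_distrr/=; set S := \sum_(k < K) _ => h1.
have cq : 0 < c `^ q by rewrite powR_gt0.
rewrite -mulrA mulrCA ler_pdivlMl//; lra.
Qed.

Lemma besov_sup_ge : exists2 c : R, 0 < c & forall f : Om -> R,
  measurable_fun setT f -> star_fin f -> forall B : R,
  besov mu p r beta alpha s +oo f = B%:E -> forall k,
  W k * (F f k.+1 - F f k) <= c * B.
Proof.
have [c c0 H] := besov_integrand_ge.
exists c^-1; first by rewrite invr_gt0.
move=> f mf ff B; rewrite /besov /norm_dlog /sup_on => EB k.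
rewrite ler_pdivlMl// -lee_fin -EB.
have ct : cell 1 2 k (grid 1 2 k.+1 : R).
  by rewrite /cell/= in_itv/= lexx/=; exact: (grid_ltS ltr01 (ltr1n R 2)).
apply: le_trans (H f mf ff k _ ct) _; apply: ereal_sup_ubound.
exists (grid 1 2 k.+1) => //=.
by rewrite in_itv/= andbT (cell_gt0 ltr01 (ltr1n R 2) k _ ct).
Qed.

(** Reduction to functions of finite norm, for which [f^*] is finite. *)
Lemma preceq_of_finite (q : \bar R) (A : (Om -> R) -> \bar R) (c : R) : 0 < c ->
  (forall f B S, measurable_fun setT f -> 0 <= B -> 0 <= S ->
    besov mu p r beta alpha s q f = B%:E -> sum_norm mu gamma f = S%:E ->
    star_fin f -> F f 0%N <= (1 + tau `^ (- gamma^-1)) * S ->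
    (A f <= (c * (B + S))%:E)%E) ->
  le_on_measurable c A
    (fun f => besov mu p r beta alpha s q f + sum_norm mu gamma f)%E.
Proof.
move=> c0 H f mf /=.
have muT : (0 < mu [set: Om])%E by rewrite Hinf.
move: (H f); have := besov_ge0 q f; have := sum_norm_ge0 (mu := mu) gamma f.
have st t : 0 < t -> _ := fun t0 => rearrangement_le_sum_norm gamma t muT gamma0 t0 f.
move: st; case: (sum_norm mu gamma f) => [S| |] st S0; [| |by move: S0; rewrite
  leeNy_eq]; last first.
  by move=> B0 _; rewrite addey -?ltNye ?(lt_le_trans _ B0)// gt0_muley ?leey// lte_fin.
case: (besov mu p r beta alpha s q f) => [B| |] B0 {}H; [| |by move: B0; rewrite
  leeNy_eq]; last first.
  by rewrite addye// gt0_muley ?leey// lte_fin.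
rewrite -EFinD -EFinM; rewrite !lee_fin in B0 S0.
have ff : star_fin f.
  move=> k; rewrite ge0_fin_numE; last exact: rearrangement_ge0.
  by apply: le_lt_trans (st _ (grid_gt0 tau0 N1 k)) _; rewrite -EFinM ltry.
apply: H => //; rewrite -lee_fin fineK//.
have -> : grid tau N 0 = tau by rewrite /grid expr0 divr1.
by rewrite EFinM; exact: st.
Qed.

(** From sequences back to functions: on each cell the integrand is at most its
    weight times [F_(k+1)^q], and on [[tau, 1[] a multiple of [F_0^q]. *)
Lemma int_transfer (q C : R) (om : R -> R) (v : nat -> R) :
  0 < q -> 0 <= C -> (forall k, 0 <= v k) -> hardy_pair q W v ->
  (forall t, 0 < t < 1 -> 0 <= om t) ->
  (forall k t, cell tau N k t -> om t <= C * v k) ->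
  (forall t, tau <= t < 1 -> om t <= C) ->
  preceq (fun f : Om -> R => (int_dlog `]0%R, 1%R[ (fun t =>
      (om t)%:E * star f t `^ q) `^ q^-1)%E)
    (fun f => besov mu p r beta alpha s q%:E f + sum_norm mu gamma f)%E.
Proof.
move=> q0 C0 v0 [C1 C10 H1] om0 omc om1.
have [c2 c20 H2] := besov_sum_ge q q0.
set cS := 1 + tau `^ (- gamma^-1).
have cS0 : 0 < cS by rewrite ltr_pwDl// powR_ge0.
pose G := (N - 1) * (C * (C1 * (cS `^ q + c2))) + C * cS `^ q / tau.
have N10 : 0 <= N - 1 by rewrite subr_ge0 ltW.
have cSq : 0 <= cS `^ q by exact: powR_ge0.
have G1 : 0 <= C1 * (cS `^ q + c2) by apply: mulr_ge0; [exact: ltW|apply: addr_ge0;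
  [|exact: ltW]].
have G0 : 0 <= G.
  apply: addr_ge0; first by apply: mulr_ge0 => //; apply: mulr_ge0.
  by apply: divr_ge0; [exact: mulr_ge0|exact: ltW].
have c0 : 0 < 1 + G `^ q^-1 by rewrite ltr_pwDl// powR_ge0.
exists (1 + G `^ q^-1) => //; apply: preceq_of_finite => // f B S mf B0 S0 EB ES ff F0S.
have Fnd := F_nondecreasing f ff.
have T0 : 0 <= B + S by rewrite addr_ge0.
have Tq z : 0 <= z -> z <= B + S -> z `^ q <= (B + S) `^ q.
  by move=> z0 zT; rewrite ge0_ler_powR ?nnegrE ?(ltW q0).
have F00 : 0 <= F f 0%N by case/andP: (Fnd 0%N).
have F0q : F f 0%N `^ q <= cS `^ q * (B + S) `^ q.
  apply: (@le_trans _ _ ((cS * S) `^ q)).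
    by rewrite ge0_ler_powR ?nnegrE ?(ltW q0) ?mulr_ge0// ltW.
  rewrite powRM ?(ltW cS0)// ler_wpM2l// Tq// lerDr//.
have sumF K : \sum_(k < K) v k * F f k.+1 `^ q <= C1 * (cS `^ q + c2) * (B + S) `^ q.
  apply: (le_trans (H1 (F f) Fnd K)); rewrite -mulrA ler_pM2l// mulrDl lerD//.
  apply: (le_trans (H2 f mf ff B EB K)); rewrite ler_pM2l// Tq// lerDl//.
have star_ge0 t : (0 <= star f t)%E by exact: rearrangement_ge0.
have star_le k t : grid tau N k <= t -> (star f t <= (F f k)%:E)%E.
  by move=> kt; rewrite fineK//; exact: rearrangement_le.
have sq k t : grid tau N k <= t -> (star f t `^ q <= (F f k `^ q)%:E)%E.
  by move=> kt; rewrite -poweR_EFin; apply: le_poweR; [exact: ltW|exact: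
    star_ge0|exact: star_le].
set I := int_dlog _ _.
have II : (I <= (G * (B + S) `^ q)%:E)%E.
  apply: (int_dlog_le_cells tau0 N1 _ (fun k => C * (v k * F f k.+1 `^ q)) (C * F f
    0%N `^ q)) => //.
  - by move=> t t01; apply: mule_ge0; [rewrite lee_fin om0|exact: poweR_ge0].
  - by move=> k; apply: mulr_ge0 => //; apply: mulr_ge0 => //; exact: powR_ge0.
  - by apply: mulr_ge0 => //; exact: powR_ge0.
  - move=> k t ct; rewrite mulrA EFinM.
    have t01 : 0 < t < 1.
      by rewrite (cell_gt0 tau0 N1 k t ct) (lt_trans (cell_lt tau0 N1 k t ct)).
    apply: lee_pmul; [by rewrite lee_fin om0|exact: poweR_ge0|by rewrite lee_fin omc|].
    by apply: sq; move: ct; rewrite /cell/= in_itv/= => /andP[].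
  - move=> t t01; rewrite EFinM.
    have t01' : 0 < t < 1 by case/andP: t01 => h ->; rewrite (lt_le_trans tau0 h).
    apply: lee_pmul; [by rewrite lee_fin om0|exact: poweR_ge0|by rewrite lee_fin om1|].
    by apply: sq; case/andP: t01; rewrite /grid expr0 divr1.
  - move=> K; rewrite /G [leRHS]mulrDl -big_distrr/=; apply: lerD.
      rewrite -mulrA ler_wpM2l// -mulrA ler_wpM2l//; exact: sumF.
    rewrite [leRHS](_ : _ = C * (cS `^ q * (B + S) `^ q) / tau); last by ring.
    by rewrite ler_wpM2r ?invr_ge0 ?(ltW tau0)// ler_wpM2l.
have I0 : (0 <= I)%E.
  apply: integral_ge0 => t; rewrite /= in_itv/= => /andP[t0 t1].
  by apply: mule_ge0; [apply: mule_ge0; [rewrite lee_fin om0// t0|exact: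
    poweR_ge0]|rewrite lee_fin invr_ge0 ltW].
have qi : 0 <= q^-1 by rewrite invr_ge0 ltW.
apply: (le_trans (le_poweR _ _ _ qi I0 II)).
rewrite poweR_EFin lee_fin powRM ?powR_ge0// -powRrM divff ?gt_eqF// powRr1//.
by rewrite ler_wpM2r// lerDr.
Qed.

(** The same passage for [q = +oo]. *)
Lemma sup_transfer (C : R) (D : set R) (om : R -> R) (z : nat -> R) :
  0 <= C -> (forall k, 0 <= z k) -> sup_pair W z ->
  D `<=` `]0, 1]%classic ->
  (forall t, D t -> 0 <= om t) ->
  (forall k t, cell tau N k t -> om t * z k.+1 <= C) ->
  (forall t, tau <= t <= 1 -> om t <= C) ->
  preceq (fun f : Om -> R => sup_on D (fun t => (om t)%:E * star f t)%E)
    (fun f => besov mu p r beta alpha s +oo f + sum_norm mu gamma f)%E.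
Proof.
move=> C0 z0 [C1 C10 H1] D01 om0 omc om1.
have [c2 c20 H2] := besov_sup_ge.
set cS := 1 + tau `^ (- gamma^-1).
have cS0 : 0 < cS by rewrite ltr_pwDl// powR_ge0.
pose G := C * (C1 * (cS + c2)) + C * cS.
have G1 : 0 <= C1 * (cS + c2) by apply: mulr_ge0; [exact: ltW|apply: addr_ge0; exact:
  ltW].
have CG : 0 <= C * (C1 * (cS + c2)) by exact: mulr_ge0.
have CcS : 0 <= C * cS by apply: mulr_ge0 => //; exact: ltW.
have G0 : 0 <= G by exact: addr_ge0.
have c0 : 0 < 1 + G by rewrite ltr_pwDl.
exists (1 + G) => //; apply: preceq_of_finite => // f B S mf B0 S0 EB ES ff F0S.
have Fnd := F_nondecreasing f ff.
have T0 : 0 <= B + S by rewrite addr_ge0.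
have F00 : 0 <= F f 0%N by case/andP: (Fnd 0%N).
have Fk k : F f k <= C1 * (cS + c2) * (B + S) * z k.
  have M0 : 0 <= c2 * B by rewrite mulr_ge0// ltW.
  apply: (le_trans (H1 (F f) (c2 * B) Fnd M0 (H2 f mf ff B EB) k)).
  rewrite ler_wpM2r// -mulrA ler_pM2l// mulrDl lerD//.
    by apply: (le_trans F0S); rewrite ler_pM2l// lerDr.
  by rewrite ler_pM2l// lerDl.
have star_ge0 t : (0 <= star f t)%E by exact: rearrangement_ge0.
have star_le k t : grid tau N k <= t -> (star f t <= (F f k)%:E)%E.
  by move=> kt; rewrite fineK//; exact: rearrangement_le.
apply: ge_ereal_sup => _ [t Dt <-].
have /= := D01 t Dt; rewrite in_itv/= => /andP[t0 t1].
have [tt|tt] := ltP t tau.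
  have [|k ck] := cell_exists tau0 N1 t; first by rewrite t0.
  have /(star_le k.+1) h : grid tau N k.+1 <= t.
    by move: ck; rewrite /cell/= in_itv/= => /andP[].
  apply: (@le_trans _ _ (om t * F f k.+1)%:E).
    by rewrite EFinM; apply: lee_pmul => //; rewrite lee_fin om0.
  rewrite lee_fin; apply: (@le_trans _ _ (om t * (C1 * (cS + c2) * (B + S) * z k.+1))).
    by rewrite ler_wpM2l ?om0.
  rewrite [leLHS](_ : _ = om t * z k.+1 * (C1 * (cS + c2)) * (B + S)); last by ring.
  rewrite ler_wpM2r//; apply: (@le_trans _ _ (C * (C1 * (cS + c2)))).
    by rewrite ler_wpM2r// omc.
  by rewrite /G addrCA lerDl; exact: addr_ge0.
have /(star_le 0%N) h : grid tau N 0 <= t by rewrite /grid expr0 divr1.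
apply: (@le_trans _ _ (C * (cS * S))%:E).
  rewrite EFinM; apply: lee_pmul; [by rewrite lee_fin om0|exact: star_ge0| |].
    by rewrite lee_fin om1// tt.
  by apply: (le_trans h); rewrite lee_fin.
rewrite lee_fin mulrA; apply: (@le_trans _ _ (C * cS * (B + S))).
  by apply: ler_wpM2l => //; rewrite lerDr.
by rewrite ler_wpM2r// /G addrA lerDr; exact: addr_ge0.
Qed.

End transfer.

(** * Embeddings for each family of weights *)

Lemma eq_preceq {R : realType} {d} {Om : measurableType d}
    (A A' B : (Om -> R) -> \bar R) :
  (forall f, A f = A' f) -> preceq A B -> preceq A' B.
Proof. by move=> /funext <-. Qed.

Lemma eq_int_dlog {R : realType} (D : set R) (h h' : R -> \bar R) :
  (forall t, D t -> h t = h' t) -> int_dlog D h = int_dlog D h'.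
Proof. by move=> hh; apply: eq_integral => t; rewrite inE => /hh ->. Qed.

Lemma eq_sup_on {R : realType} (D : set R) (h h' : R -> \bar R) :
  (forall t, D t -> h t = h' t) -> sup_on D h = sup_on D h'.
Proof.
move=> hh; congr ereal_sup; apply/seteqP; split => _ [t Dt <-].
  by exists t => //; rewrite hh.
by exists t => //; rewrite hh.
Qed.

Lemma log_ge1 {R : realType} (t : R) : 0 < t <= 1 -> 1 <= 1 + ln t^-1.
Proof. by move=> /andP[t0 t1]; rewrite lerDl ln_ge0// invf_ge1. Qed.

Lemma loglog_ge1 {R : realType} (t : R) : 0 < t <= 1 ->
  1 <= 1 + ln (1 + ln t^-1).
Proof. by move=> t01; rewrite lerDl ln_ge0// log_ge1. Qed.

(** From [1 + k <= (1 + ln (1/t)) / m] one gets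
    [1 + ln (1 + k) <= (1 + a) (1 + ln (1 + ln (1/t)))] with [a = ln (1/m)]. *)
Lemma cell_loglog {R : realType} (tau N : R) : 0 < tau < 1 -> 1 < N ->
  exists2 c : R, 0 < c & forall k t, cell tau N k t ->
    c * log_index k <= 1 + ln (1 + ln t^-1).
Proof.
move=> tau01 N1; have [tau0 tau1] := andP tau01.
have [c1 [c2 [c10 c20 H]]] := cell_log tau01 N1.
pose m := Num.min c1 1.
have m0 : 0 < m by rewrite lt_min c10 ltr01.
have m1 : m <= 1 by rewrite ge_min lexx orbT.
pose a := ln m^-1; have a0 : 0 <= a by rewrite ln_ge0// invf_ge1.
have c0 : 0 < (1 + a)^-1 by rewrite invr_gt0 ltr_pwDl.
exists (1 + a)^-1 => // k t ct.
have t0 := cell_gt0 tau0 N1 k t ct.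
have t1 : t <= 1 by apply: ltW; exact: cell_lt1 tau01 N1 k t ct.
have L1 : 1 <= 1 + ln t^-1 by rewrite log_ge1// t0.
have /andP[h _] := H k t ct.
have lL : 0 <= ln (1 + ln t^-1) by rewrite ln_ge0.
rewrite ler_pdivrMl ?ltr_pwDl//.
have h2 : m * (1 + k%:R) <= 1 + ln t^-1.
  by apply: le_trans h; rewrite ler_wpM2r ?ge_min ?lexx// ltW// natS_gt0.
have h3 : ln (1 + k%:R) <= a + ln (1 + ln t^-1).
  have L0 : 0 < 1 + ln t^-1 by exact: lt_le_trans L1.
  rewrite -lnM ?posrE ?invr_gt0//.
  rewrite ler_ln ?posrE ?natS_gt0 ?mulr_gt0 ?invr_gt0//.
  by rewrite ler_pdivlMl.
have : 0 <= a * ln (1 + ln t^-1) by exact: mulr_ge0.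
rewrite /log_index; lra.
Qed.

Section embeddings.
Context {R : realType} {d : measure_display} {Om : metricMeasurableType R d}.
Context {mu : {measure set Om -> \bar R}} (Hd : doubling_space mu).
Context (Hinf : mu [set: Om] = +oo%E) {b : R} (b0 : 0 < b).
Context (Hnc : forall y : Om, (b%:E <= mu (ball y 1))%E).
Context {p : R} {r : \bar R} {beta s alpha gamma : R}.
Context (p0 : 0 < p) (r0 : (0 < r)%E) (s0 : 0 < s).
Context (alpha01 : 0 < alpha <= 1) (gamma0 : 0 < gamma).

Let N : R := C_mu mu.
Let tau := grid_scale (mu := mu) b.
Let N1 : 1 < N. Proof. exact: C_mu_gt1. Qed.
Let N0 : 0 < N. Proof. exact: lt_trans N1. Qed.
Let tau01 : 0 < tau < 1. Proof. exact: grid_scale_itv. Qed.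
Let tau0 : 0 < tau. Proof. by case/andP: tau01. Qed.
Let star (f : Om -> R) : R -> \bar R := rearrangement mu (EFin \o f).
Let star0 f t : (0 <= star f t)%E. Proof. exact: rearrangement_ge0. Qed.
Let kappa : R := 2 `^ s * N `^ (- p^-1).
Let rhs (q : \bar R) (f : Om -> R) : \bar R :=
  (besov mu p r beta alpha s q f + sum_norm mu gamma f)%E.
Let L (t : R) : R := 1 + ln t^-1.
Let LL (t : R) : R := 1 + ln (1 + ln t^-1).

Let t01w (t : R) : 0 < t < 1 -> 0 < t <= 1.
Proof. by move=> /andP[-> /ltW]. Qed.
Let top01 (t : R) : tau <= t <= 1 -> 0 < t <= 1.
Proof. by move=> /andP[h ->]; rewrite (lt_le_trans tau0 h). Qed.
Let top01' (t : R) : tau <= t < 1 -> 0 < t <= 1.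
Proof. by move=> /andP[h /ltW ->]; rewrite (lt_le_trans tau0 h). Qed.

Section subcritical.
Context (e : R) (e0 : 0 < e) (eE : N `^ (- e) = kappa).

Let kappa01 : 0 < kappa < 1.
Proof.
rewrite -eE powR_gt0//= powRN invf_lt1 ?powR_gt0//.
by have := @gt0_ltr_powR R e e0 1 N; rewrite powR1; apply; rewrite ?nnegrE ?(ltW N0).
Qed.

Let w (t : R) : R := t `^ e * L t `^ beta.
Let W k : R := kappa ^+ k * (1 + k%:R) `^ beta.
Let w0 t : 0 <= w t. Proof. by rewrite mulr_ge0// powR_ge0. Qed.
Let W0 k : 0 < W k.
Proof. by case/andP: kappa01 => k0 _; rewrite mulr_gt0 ?exprn_gt0 ?powR_gt0//
  natS_gt0. Qed.

Lemma subcritical_weight : exists2 C : R, 0 < C &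
  (forall k t, cell tau N k t -> w t <= C * W k) /\
  (forall t, tau <= t <= 1 -> w t <= C).
Proof.
have [K K0 HK] := cell_log_powR tau01 N1 beta.
have lt0 : 0 <= ln tau^-1 by rewrite ln_ge0// invf_ge1//; case/andP: tau01 => _ /ltW.
have [K' K'0 HK'] := @powR_comparable R 1 (1 + ln tau^-1) beta ltr01.
exists (tau `^ e * K + K'); first by rewrite addr_gt0// mulr_gt0// powR_gt0.
split=> [k t ct|t tt].
  have [h _] := HK k t ct; apply: (@le_trans _ _ (tau `^ e * kappa ^+ k * (K * (1 +
    k%:R) `^ beta))).
    apply: ler_pM; rewrite ?powR_ge0// -eE -gridE_powR//.
    rewrite ge0_ler_powR ?nnegrE ?(ltW e0)//.
    - exact: ltW (cell_gt0 tau0 N1 k t ct).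
    - exact: ltW (grid_gt0 tau0 N1 k).
    - by move: ct; rewrite /cell/= in_itv/= => /andP[_ /ltW].
  rewrite [leLHS](_ : _ = tau `^ e * K * W k); last by rewrite /W; ring.
  by rewrite ler_wpM2r ?(ltW (W0 _))// lerDl ltW.
have /andP[t0 t1] := top01 _ tt.
apply: (@le_trans _ _ (1 * K')); last by rewrite mul1r lerDr mulr_ge0 ?powR_ge0// ltW.
apply: ler_pM; rewrite ?powR_ge0//.
  rewrite -(powRr0 t); case/andP: tt => _ _.
  by have := @ger_powR R t; rewrite t0 t1 => /(_ isT) H; apply: H; exact: ltW.
have := HK' (L t) 1 ltr01; rewrite powR1 !mulr1; apply.
rewrite log_ge1 ?t0 ?t1//= lerD2l ler_ln ?posrE ?invr_gt0// lef_pV2 ?posrE//.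
by case/andP: tt.
Qed.

Lemma subcritical_int q : 0 < q ->
  preceq (fun f : Om -> R => (int_dlog `]0%R, 1%R[ (fun t =>
      ((t `^ e * L t `^ beta)%:E * star f t) `^ q) `^ q^-1)%E) (rhs q%:E).
Proof.
move=> q0; have [C C0 [HC HC']] := subcritical_weight.
have := int_transfer (beta := beta) Hd Hinf b0 Hnc p0 r0 s0 alpha01 gamma0 q (C `^ q)
  (fun t => w t `^ q)
  (fun k => W k `^ q) q0 (powR_ge0 _ _).
move=> H; apply: eq_preceq (H _ _ _ _ _).
- move=> f; congr (_ `^ _)%E; apply: eq_int_dlog => t _.
  by rewrite poweRM; [|rewrite lee_fin; exact: w0|exact: star0].
- by move=> k; exact: powR_ge0.
- exact: hardy_geometric.
- by move=> t _; exact: powR_ge0.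
- move=> k t ct; rewrite -powRM ?(ltW C0) ?(ltW (W0 k))//.
  by apply: le_powR; [exact: ltW|exact: w0|exact: HC].
- move=> t /andP[t1 t2]; apply: le_powR; [exact: ltW|exact: w0|].
  by apply: HC'; rewrite t1 ltW.
Qed.

Lemma subcritical_sup :
  preceq (fun f : Om -> R => sup_on `]0%R, 1%R[ (fun t =>
      (t `^ e * L t `^ beta)%:E * star f t)%E) (rhs +oo).
Proof.
have [C C0 [HC HC']] := subcritical_weight.
have [K K0 HK] := @natS_powR_step R beta.
have k0 : 0 < kappa by case/andP: kappa01.
have CK : 0 <= C * K / kappa := ltW (divr_gt0 (mulr_gt0 C0 K0) k0).
apply: (sup_transfer (beta := beta) Hd Hinf b0 Hnc p0 r0 s0 alpha01 gamma0 (C * K /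
  kappa + C) _ w (fun k => (W k)^-1)).
- exact: addr_ge0 CK (ltW C0).
- by move=> k; rewrite invr_ge0 ltW.
- exact: sup_geometric.
- by move=> t; rewrite /= !in_itv/= => /andP[-> /ltW].
- by move=> t _; exact: w0.
- move=> k t ct; rewrite ler_pdivrMr//; apply: (le_trans (HC k t ct)).
  apply: (@le_trans _ _ (C * K / kappa * W k.+1)); last first.
    by rewrite ler_wpM2r ?(ltW (W0 _))// lerDl ltW.
  rewrite /W exprS [leRHS](_ : _ = C * (kappa ^+ k * (K * (1 + k.+1%:R) `^ beta)));
    last first.
    by field; rewrite gt_eqF.
  by rewrite ler_pM2l// ler_pM2l ?exprn_gt0.
- move=> t tt; apply: (le_trans (HC' t tt)).
  by rewrite lerDr.
Qed.

End subcritical.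

Section critical.
Context (kappa1 : kappa = 1).

Let W_E : (fun k => (1 + k%:R) `^ beta) = (fun k => kappa ^+ k * (1 + k%:R) `^ beta).
Proof. by apply/funext => k; rewrite kappa1 expr1n mul1r. Qed.

Let L0 (t : R) : 0 < t <= 1 -> 0 < L t.
Proof. by move=> /log_ge1; apply: lt_le_trans. Qed.

Let LL0 (t : R) : 0 < t <= 1 -> 0 < LL t.
Proof. by move=> /loglog_ge1; apply: lt_le_trans. Qed.

Let powR_le1 (x e : R) : 1 <= x -> e <= 0 -> x `^ e <= 1.
Proof. by move=> x1 e0; rewrite -(powRr0 x) ler_powR. Qed.

Let cell01 k t : cell tau N k t -> 0 < t <= 1.
Proof.
by move=> ct; rewrite (cell_gt0 tau0 N1 k t ct) (ltW (cell_lt1 tau01 N1 k t ct)).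
Qed.

Lemma critical_power_int a q : 0 < a <= 1 -> a <= q -> beta * q < q / a - 1 ->
  preceq (fun f : Om -> R => (int_dlog `]0%R, 1%R[ (fun t =>
      star f t `^ q * (L t `^ (beta * q - q / a))%:E) `^ q^-1)%E) (rhs q%:E).
Proof.
move=> aa aq bq; have [a0 _] := andP aa.
have q0 : 0 < q by exact: lt_le_trans aq.
have [K K0 HK] := cell_log_powR tau01 N1 (beta * q - q / a).
have := int_transfer (beta := beta) Hd Hinf b0 Hnc p0 r0 s0 alpha01 gamma0 q (K + 1)
  (fun t => L t `^ (beta * q - q / a))
  (fun k => (1 + k%:R) `^ (beta * q - q / a)) q0.
move=> H; apply: eq_preceq (H _ _ _ _ _ _).
- by move=> f; congr (_ `^ _)%E; apply: eq_int_dlog => t _; rewrite muleC.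
- by rewrite addr_ge0// ltW.
- by move=> k; exact: powR_ge0.
- rewrite -W_E; exact: hardy_power.
- by move=> t _; exact: powR_ge0.
- move=> k t ct; apply: (le_trans (HK k t ct).1).
  by rewrite ler_wpM2r ?powR_ge0// lerDl.
- move=> t /top01' t01; apply: (@le_trans _ _ 1); last by rewrite lerDr ltW.
  apply: powR_le1; [exact: log_ge1|lra].
Qed.

(** The same embedding, with the weight inside the power. *)
Lemma critical_power_int' a q : 0 < a <= 1 -> a <= q -> beta * q < q / a - 1 ->
  preceq (fun f : Om -> R => (int_dlog `]0%R, 1%R[ (fun t =>
      (star f t * ((L t `^ (a^-1 - beta))^-1)%:E) `^ q) `^ q^-1)%E) (rhs q%:E).
Proof.
move=> aa aq bq; apply: eq_preceq (critical_power_int a q aa aq bq) => f.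
congr (_ `^ _)%E; apply: eq_int_dlog => t _.
rewrite poweRM ?star0// ?lee_fin ?invr_ge0 ?powR_ge0//; congr (_ * _)%E.
rewrite poweR_EFin -powRN -powRrM; congr (_ `^ _)%:E; ring.
Qed.

Lemma critical_power_sup a : 0 < a <= 1 -> beta < a^-1 ->
  preceq (fun f : Om -> R => sup_on `]0%R, 1%R] (fun t =>
      star f t * ((L t `^ (a^-1 - beta))^-1)%:E)%E) (rhs +oo).
Proof.
move=> aa ba; set e := a^-1 - beta; have e0 : 0 < e by rewrite subr_gt0.
have [K K0 HK] := cell_log_powR tau01 N1 e.
have := sup_transfer (beta := beta) Hd Hinf b0 Hnc p0 r0 s0 alpha01 gamma0 (2 `^ e *
  K + 1) `]0, 1]%classic
  (fun t => (L t `^ e)^-1) (fun k => (1 + k%:R) `^ e).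
move=> H; apply: eq_preceq (H _ _ _ _ _ _ _).
- by move=> f; apply: eq_sup_on => t _; rewrite muleC.
- by rewrite addr_ge0// mulr_ge0 ?powR_ge0// ltW.
- by move=> k; exact: powR_ge0.
- rewrite -W_E; exact: sup_power.
- by [].
- by move=> t _; rewrite invr_ge0 powR_ge0.
- move=> k t ct; rewrite ler_pdivrMl ?powR_gt0 ?L0 ?(cell01 k)//.
  have h1 : (1 + k.+1%:R) `^ e <= 2 `^ e * (1 + k%:R) `^ e.
    rewrite -powRM ?(ltW (natS_gt0 _))//.
    by apply: le_powR; [exact: ltW|exact: ltW (natS_gt0 _)|exact: natS_double].
  apply: (le_trans h1); have [_ h2] := HK k t ct.
  apply: (@le_trans _ _ (2 `^ e * (K * L t `^ e))).
    by rewrite ler_wpM2l ?powR_ge0.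
  rewrite [leRHS](_ : _ = 2 `^ e * (K * L t `^ e) + L t `^ e); last by ring.
  by rewrite lerDl powR_ge0.
- move=> t /top01 t01; apply: (@le_trans _ _ 1); last by rewrite lerDr mulr_ge0
  ?powR_ge0// ltW.
  by rewrite -powRN; apply: powR_le1; [exact: log_ge1|rewrite oppr_le0 ltW].
Qed.

Lemma critical_log_int a q : 0 < a <= 1 -> a < q -> beta * q = q / a - 1 ->
  preceq (fun f : Om -> R => (int_dlog `]0%R, 1%R[ (fun t =>
      star f t `^ q * ((L t * LL t `^ (q / a))^-1)%:E) `^ q^-1)%E) (rhs q%:E).
Proof.
move=> aa aq bq; have [a0 _] := andP aa.
have q0 : 0 < q by exact: lt_trans aq.
have [c1 [c2 [c10 _ H1]]] := cell_log tau01 N1.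
have [c c0 Hc] := @cell_loglog R tau N tau01 N1.
set P := q / a; have P0 : 0 < P by rewrite divr_gt0.
pose K := (c1 * c `^ P)^-1.
have K0 : 0 < K by rewrite invr_gt0 mulr_gt0// powR_gt0.
have l0 k : 0 < log_index k :> R by case/andP: (@log_index_le R k).
have := int_transfer (beta := beta) Hd Hinf b0 Hnc p0 r0 s0 alpha01 gamma0 q (K + 1)
  (fun t => (L t * LL t `^ P)^-1)
  (fun k => ((1 + k%:R) * log_index k `^ P)^-1) q0.
move=> H; apply: eq_preceq (H _ _ _ _ _ _).
- by move=> f; congr (_ `^ _)%E; apply: eq_int_dlog => t _; rewrite muleC.
- by rewrite addr_ge0// ltW.
- by move=> k; rewrite invr_ge0 mulr_ge0 ?powR_ge0// ltW// natS_gt0.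
- rewrite -W_E; exact: hardy_log.
- by move=> t /t01w t01; rewrite invr_ge0 mulr_ge0 ?powR_ge0// ltW// L0.
- move=> k t ct; have t01 := cell01 k t ct.
  apply: (@le_trans _ _ (K * ((1 + k%:R) * log_index k `^ P)^-1)); last first.
    by rewrite ler_wpM2r ?lerDl// invr_ge0 mulr_ge0 ?powR_ge0// ltW// natS_gt0.
  rewrite /K -invfM lef_pV2 ?posrE ?mulr_gt0 ?powR_gt0 ?L0 ?LL0 ?natS_gt0//.
  rewrite [leLHS](_ : _ = (c1 * (1 + k%:R)) * (c * log_index k) `^ P); last first.
    by rewrite powRM ?(ltW c0) ?(ltW (l0 k))//; ring.
  have /andP[h _] := H1 k t ct.
  apply: ler_pM => //; [by rewrite mulr_ge0 ?(ltW c10) ?(ltW (natS_gt0 k))|exact: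
    powR_ge0|].
  by apply: le_powR; [exact: ltW|exact: ltW (mulr_gt0 c0 (l0 k))|exact: Hc].
- move=> t /top01' t01; apply: (@le_trans _ _ 1); last by rewrite lerDr ltW.
  rewrite invf_le1 ?mulr_gt0 ?powR_gt0 ?L0 ?LL0//.
  rewrite -[leLHS]mulr1 ler_pM//; first exact: log_ge1.
  by rewrite -(powRr0 (LL t)) ler_powR ?(ltW P0)//; exact: loglog_ge1.
Qed.

Lemma critical_log_sup : 1 <= beta ->
  preceq (fun f : Om -> R => sup_on `]0%R, 1%R] (fun t =>
      star f t * ((LL t `^ beta)^-1)%:E)%E) (rhs +oo).
Proof.
move=> be1; have be0 : 0 < beta by exact: lt_le_trans be1.
have [c c0 Hc] := @cell_loglog R tau N tau01 N1.
have l0 k : 0 < log_index k :> R by case/andP: (@log_index_le R k).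
have := sup_transfer (beta := beta) Hd Hinf b0 Hnc p0 r0 s0 alpha01 gamma0 ((2 / c)
  `^ beta + 1) `]0, 1]%classic
  (fun t => (LL t `^ beta)^-1) (fun k => log_index k `^ beta).
move=> H; apply: eq_preceq (H _ _ _ _ _ _ _).
- by move=> f; apply: eq_sup_on => t _; rewrite muleC.
- by rewrite addr_ge0// powR_ge0.
- by move=> k; exact: powR_ge0.
- rewrite -W_E; exact: sup_log.
- by [].
- by move=> t _; rewrite invr_ge0 powR_ge0.
- move=> k t ct; have t01 := cell01 k t ct.
  rewrite ler_pdivrMl ?powR_gt0 ?LL0//.
  apply: (@le_trans _ _ ((2 / c) `^ beta * LL t `^ beta)); last first.
    by rewrite mulrC ler_wpM2l ?powR_ge0// lerDl.
  have LLt := LL0 _ t01.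
  rewrite -powRM ?divr_ge0 ?(ltW c0) ?(ltW LLt)//.
  apply: le_powR; [exact: ltW|exact: ltW (l0 _)|].
  apply: (le_trans (log_index_double k)); rewrite -mulrA ler_pM2l// ler_pdivlMl//.
  exact: Hc.
- move=> t /top01 t01; apply: (@le_trans _ _ 1); last by rewrite lerDr powR_ge0.
  by rewrite -powRN; apply: powR_le1; [exact: loglog_ge1|rewrite oppr_le0 ltW].
Qed.

End critical.
End embeddings.

(** * Embeddings of Besov spaces over Lorentz-Zygmund spaces *)

Lemma min1_itv {R : realType} (r : \bar R) : (0 < r)%E -> 0 < min1 r <= 1.
Proof.
rewrite /min1; case: r => [r| |]//.
  rewrite lte_fin => r0; rewrite -EFin_min/= lt_min ltr01 r0/=.
  by rewrite ge_min lexx.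
by move=> _; rewrite min_l ?leey//= ltr01 lexx.
Qed.

Lemma recip_fin {R : realType} (q : R) : 0 < q -> recip q%:E = q^-1.
Proof. by move=> q0; rewrite /recip inver gt_eqF. Qed.

Lemma cvg_left_pinfty {R : realType} (p : R) (f : R -> R) :
  0 < p -> (forall a, 0 < a < p -> 0 < f a) ->
  f a + (p - a)^-1 @[a --> p^'-] --> +oo.
Proof.
move=> p0 f0; apply/cvgryPge => A.
pose d := (`|A| + 1)^-1.
have d0 : 0 < d by rewrite invr_gt0 ltr_wpDl.
near=> a.
have ap : a < p by near: a; exact: nbhs_left_lt.
have a0 : 0 < a by near: a; exact: nbhs_left_gt.
have ad : p - d < a by near: a; apply: nbhs_left_gt; rewrite ltrBlDr ltrDl.
have h : `|A| + 1 <= (p - a)^-1.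
  rewrite -[leLHS]invrK lef_pV2 ?posrE ?subr_gt0//.
  by rewrite lerBlDr addrC -lerBlDr ltW.
have := f0 a; rewrite a0 ap => /(_ isT) fa.
have := ler_norm A; lra.
Unshelve. all: by end_near. Qed.

Theorem theorem25 (R : realType) (d : measure_display)
  (Om : metricMeasurableType R d) (mu : {measure set Om -> \bar R})
  (Hdoubling : doubling_space mu)
  (Hinfinite : mu [set: Om] = +oo%E)
  (Hnoatom : forall x : Om, mu [set x] = 0%E)
  (b : R) (Hb : 0 < b)
  (Hnoncollapsing : ereal_inf [set mu (ball x 1) | x in [set: Om]] = b%:E)
  (p : R) (r : \bar R) (beta : R) (Hp : 0 < p) (Hr : (0 < r)%E)
  (s : R) (q : \bar R) (Hs : 0 < s < 1) (Hq : (0 < q)%E) :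
  let Q := upper_dimension mu in
  let fstar (f : Om -> R) := rearrangement mu (EFin \o f) in
  let L (t : R) : R := 1 + ln t^-1 in
  let LL (t : R) : R := 1 + ln (1 + ln t^-1) in
  let m := min1 r in
  let mp := Num.min m p in
  let rhs (alpha gamma : R) (f : Om -> R) : \bar R :=
    (besov mu p r beta alpha s q f + sum_norm mu gamma f)%E in
  (* part 1 *)
  (s < Q / p -> forall alpha : R, besov_exponent p r beta alpha ->
    (forall q' : R, q = q'%:E ->
      preceq (fun f : Om -> R => (int_dlog `]0%R, 1%R[ (fun t =>
                 ((t `^ (p^-1 - s / Q) * L t `^ beta)%:E * fstar f t) `^ q')
               `^ q'^-1)%E)
             (rhs alpha mp))
    /\
    (q = +oo%E ->
      preceq (fun f : Om -> R => sup_on `]0%R, 1%R[ (fun t =>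
                 (t `^ (p^-1 - s / Q) * L t `^ beta)%:E * fstar f t)%E)
             (rhs alpha mp)))
  /\
  (* part 2 *)
  (s = Q / p ->
   ((mp%:E < q)%E -> beta <= mp^-1 - recip q) ->
   ((q <= mp%:E)%E -> beta < 0) ->
   (* a *)
   (m < p \/ (m = p /\ 0 <= beta) ->
    forall alpha : R, besov_exponent p r beta alpha ->
    [/\ (* i *)
        beta = m^-1 - recip q -> (m%:E < q)%E ->
        (forall q' : R, q = q'%:E ->
          preceq (fun f : Om -> R => (int_dlog `]0%R, 1%R[ (fun t =>
                     fstar f t `^ q' * ((L t * LL t `^ (q' / m))^-1)%:E)
                   `^ q'^-1)%E)
                 (rhs alpha m))
        /\
        (q = +oo%E ->
          preceq (fun f : Om -> R => sup_on `]0%R, 1%R] (fun t =>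
                     fstar f t * ((LL t `^ beta)^-1)%:E)%E)
                 (rhs alpha m)),
        (* ii *)
        beta < m^-1 - recip q -> (m%:E < q)%E ->
        (forall q' : R, q = q'%:E ->
          preceq (fun f : Om -> R => (int_dlog `]0%R, 1%R[ (fun t =>
                     (fstar f t * ((L t `^ (m^-1 - beta))^-1)%:E) `^ q')
                   `^ q'^-1)%E)
                 (rhs alpha m))
        /\
        (q = +oo%E ->
          preceq (fun f : Om -> R => sup_on `]0%R, 1%R] (fun t =>
                     fstar f t * ((L t `^ (m^-1 - beta))^-1)%:E)%E)
                 (rhs alpha m))
      & (* iii *)
        beta < 0 ->
        forall q' : R, q = q'%:E -> q' <= m ->
          preceq (fun f : Om -> R => (int_dlog `]0%R, 1%R[ (fun t =>
                     fstar f t `^ q' * (L t `^ (beta * q' - 1))%:E)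
                   `^ q'^-1)%E)
                 (rhs alpha m)])
   /\
   (* b *)
   (p < m \/ (m = p /\ beta < 0) ->
    (* i *)
    (beta <= p^-1 - recip q -> (p%:E <= q)%E ->
     exists C : R -> R,
       C alpha @[alpha --> p^'-] --> +oo
       /\
       forall alpha : R, 0 < alpha < p ->
         [/\ 0 < C alpha,
             forall q' : R, q = q'%:E ->
               le_on_measurable (C alpha)
                 (fun f : Om -> R => (int_dlog `]0%R, 1%R[ (fun t =>
                    (fstar f t * ((L t `^ (alpha^-1 - beta))^-1)%:E) `^ q')
                  `^ q'^-1)%E)
                 (rhs alpha p)
           & q = +oo%E ->
               le_on_measurable (C alpha)
                 (fun f : Om -> R => sup_on `]0%R, 1%R] (fun t =>
                    fstar f t * ((L t `^ (alpha^-1 - beta))^-1)%:E)%E)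
                 (rhs alpha p)])
    /\
    (* ii *)
    (beta < 0 ->
     forall q' : R, q = q'%:E -> q' < p ->
     forall alpha : R, 0 < alpha < p ->
       preceq (fun f : Om -> R => (int_dlog `]0%R, 1%R[ (fun t =>
                  fstar f t `^ q' * (L t `^ (beta * q' - 1))%:E)
                `^ q'^-1)%E)
              (rhs alpha p)))).
Proof.
move=> Q fstar L LL m mp rhs.
have Hnc y : (b%:E <= mu (ball y 1))%E.
  by rewrite -Hnoncollapsing; apply: ereal_inf_lbound; exists y.
have [s0 _] := andP Hs.
have N1 : 1 < C_mu mu by exact: C_mu_gt1 Hdoubling Hinfinite.
have N0 : 0 < C_mu mu by exact: lt_trans N1.
have ln2 : 0 < ln (2 : R) by rewrite ln_gt0// ltr1n.
have Q0 : 0 < Q by rewrite divr_gt0// ln_gt0.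
(* [C_mu = 2^Q] *)
have keyQ : C_mu mu `^ (s / Q) = 2 `^ s.
  rewrite /powR !gt_eqF//; congr expR; rewrite /Q /upper_dimension.
  by field; rewrite !gt_eqF// ln_gt0.
have /andP[m0 m1] : 0 < m <= 1 by exact: min1_itv.
have mp0 : 0 < mp by rewrite lt_min m0.
have qpos q' : q = q'%:E -> 0 < q' by move=> qE; move: Hq; rewrite qE lte_fin.
split=> [sQ alpha [alpha01 _ _]|sQ _ _].
  pose e := p^-1 - s / Q.
  have e0 : 0 < e by rewrite subr_gt0 ltr_pdivrMr// mulrC.
  have eE : C_mu mu `^ (- e) = 2 `^ s * C_mu mu `^ (- p^-1).
    by rewrite -keyQ -powRD ?(gt_eqF N0) ?implybT// opprB.
  split=> [q' qE|qE]; rewrite /rhs qE.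
    exact: (subcritical_int Hdoubling Hinfinite Hb Hnc Hp Hr s0 alpha01 mp0 e e0 eE
      q' (qpos _ qE)).
  exact: (subcritical_sup Hdoubling Hinfinite Hb Hnc Hp Hr s0 alpha01 mp0 e e0 eE).
have sQp : s / Q = p^-1 by rewrite sQ; field; rewrite !gt_eqF.
have kappa1 : 2 `^ s * C_mu mu `^ (- p^-1) = 1.
  by rewrite -keyQ sQp -powRD ?(gt_eqF N0) ?implybT// subrr powRr0.
split=> [_ alpha [alpha01 _ _]|pm].
  split=> [bE mq|bE mq|b0 q' qE q'm].
  - split=> [q' qE|qE]; rewrite /rhs qE.
      have q0 := qpos _ qE; rewrite qE lte_fin in mq.
      apply: (critical_log_int Hdoubling Hinfinite Hb Hnc Hp Hr s0 alpha01 m0 kappa1)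
        => //.
        by rewrite m0.
      by rewrite bE qE recip_fin// mulrBl mulVf ?gt_eqF// mulrC.
    apply: (critical_log_sup Hdoubling Hinfinite Hb Hnc Hp Hr s0 alpha01 m0 kappa1).
    by rewrite bE qE /recip invey/= subr0 invf_ge1.
  - split=> [q' qE|qE]; rewrite /rhs qE.
      have q0 := qpos _ qE; rewrite qE lte_fin in mq.
      apply: (critical_power_int' Hdoubling Hinfinite Hb Hnc Hp Hr s0 alpha01 m0
        kappa1).
      + by rewrite m0.
      + exact: ltW.
      + move: bE; rewrite qE recip_fin// -(ltr_pM2r q0) mulrBl mulVf ?gt_eqF//.
        by rewrite [m^-1 * _]mulrC.
    apply: (critical_power_sup Hdoubling Hinfinite Hb Hnc Hp Hr s0 alpha01 m0 kappa1).
      by rewrite m0.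
    by move: bE; rewrite qE /recip invey/= subr0.
  (* Since [q' <= 1], the power [q'] itself is subadditive: take [a = q']. *)
  - have q0 := qpos _ qE; rewrite /rhs qE.
    have := critical_power_int (beta := beta) Hdoubling Hinfinite Hb Hnc Hp Hr s0
      alpha01 m0 kappa1 q' q'.
    rewrite divff ?gt_eqF//; apply=> //; first by rewrite q0 (le_trans q'm).
    by rewrite subrr pmulr_llt0.
have p1 : p <= 1.
  by case: pm => [/ltW pm|[pm _]]; [exact: le_trans m1|rewrite -pm].
split=> [bE pq|b0 q' qE q'p alpha /andP[a0 ap]]; last first.
  have q0 := qpos _ qE; rewrite /rhs qE.
  have alpha01 : 0 < alpha <= 1 by rewrite a0 (le_trans (ltW ap)).
  have := critical_power_int (beta := beta) Hdoubling Hinfinite Hb Hnc Hp Hr s0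
    alpha01 Hp kappa1 q' q'.
  rewrite divff ?gt_eqF//; apply=> //; first by rewrite q0 (le_trans (ltW q'p)).
  by rewrite subrr pmulr_llt0.
(* [alpha < p <= 1] is the exponent whose power is summed. *)
have each alpha : exists c : R, 0 < alpha < p -> [/\ 0 < c,
    forall q' : R, q = q'%:E -> le_on_measurable c
      (fun f : Om -> R => (int_dlog `]0%R, 1%R[ (fun t =>
         (fstar f t * ((L t `^ (alpha^-1 - beta))^-1)%:E) `^ q') `^ q'^-1)%E)
      (rhs alpha p)
  & q = +oo%E -> le_on_measurable c
      (fun f : Om -> R => sup_on `]0%R, 1%R] (fun t =>
         fstar f t * ((L t `^ (alpha^-1 - beta))^-1)%:E)%E)
      (rhs alpha p)].
  have [/andP[a0 ap]|na] := boolP (0 < alpha < p); last by exists 0.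
  have alpha01 : 0 < alpha <= 1 by rewrite a0 (le_trans (ltW ap)).
  have ipa : p^-1 < alpha^-1 by rewrite ltf_pV2 ?posrE.
  case qE : q pq bE (qpos) => [q'| |] // pq bE qp.
  - have q0 := qp _ erefl; rewrite recip_fin// in bE; rewrite lee_fin in pq.
    have [|||c c0 Hc] := @critical_power_int' _ _ _ _ Hdoubling Hinfinite _ Hb Hnc _
      _ beta
      _ _ _ Hp Hr s0 alpha01 Hp kappa1 alpha q'.
    + exact: alpha01.
    + exact: le_trans (ltW ap) pq.
    + have h : beta < alpha^-1 - q'^-1 by lra.
      by move: h; rewrite -(ltr_pM2r q0) mulrBl mulVf ?gt_eqF// [alpha^-1 * _]mulrC.
    exists c => _; split=> // q'' [] <-.
    by rewrite /rhs qE.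
  - have [||c c0 Hc] := @critical_power_sup _ _ _ _ Hdoubling Hinfinite _ Hb Hnc _ _
    beta
      _ _ _ Hp Hr s0 alpha01 Hp kappa1 alpha.
    + exact: alpha01.
    + by move: bE; rewrite /recip invey/=; lra.
    exists c => _; split=> // _.
    by rewrite /rhs qE.
have [c Hc] := choice each.
(* A valid constant stays valid when increased; the added term blows up at [p]. *)
exists (fun alpha => c alpha + (p - alpha)^-1); split.
  by apply: cvg_left_pinfty => // a /Hc[].
move=> alpha ap; have [c0 Hint Hsup] := Hc alpha ap.
have [a0 ap'] := andP ap.
have i0 : 0 < (p - alpha)^-1 by rewrite invr_gt0 subr_gt0.
have rhs0 f : (0 <= rhs alpha p f)%E.
  by rewrite adde_ge0 ?besov_ge0 ?sum_norm_ge0.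
have mono A : le_on_measurable (c alpha) A (rhs alpha p) ->
    le_on_measurable (c alpha + (p - alpha)^-1) A (rhs alpha p).
  move=> H f mf; apply: (le_trans (H f mf)); apply: lee_wpmul2r => //.
  by rewrite lee_fin lerDl ltW.
split; first exact: addr_gt0.
  by move=> q' qE; apply: mono; exact: Hint.
by move=> qE; apply: mono; exact: Hsup.
Qed.
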